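(* Let $g:\mathbb{R}_+\to\mathbb{R}_+$ be a bounded strictly decreasing function such that $\sum_{k=1}^\infty g(k)$ converges, and let $\mathcal{I}^{(g)}_{[X]}=\int_0^\infty g(X_t)\,dt$. Then the following hold. (i) $\mathcal{I}^{(g)}_{[X]}$ is finite almost surely, and it admits a probability density function on $(0,\infty)$. (ii) If the jumps of $X$ are bounded away from $0$, i.e. $\mathsf{P}\{Z_1>\delta\}=1$ for some constant $\delta>0$, then the Laplace transform $\bar\Phi^{(g)}_{[X]}(u):=\mathsf{E}\,e^{-u\mathcal{I}^{(g)}_{[X]}}$ is well-defined for $\mathrm{Re}\,u\in(-\lambda/g(0),\infty)$, so that $\mathcal{I}^{(g)}_{[X]}$ has finite moments of all orders. Moreover, it has the limit representation $$\bar\Phi^{(g)}_{[X]}(u)=\lim_{K\to\infty}\mathsf{E}\prod_{k=0}^K\frac{\lambda}{\lambda+g\bigl(\sum_{i=1}^kZ_i\bigr)u},\qquad \mathrm{Re}\,u>-\frac{\lambda}{g(0)}.$$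
   Context: $\mathbb{R}_+=[0,\infty)$; an empty sum is $0$. $X=(X_t)_{t\ge0}$ is a compound Poisson process $X_t=\sum_{i=1}^{N_t}Z_i$, where $N$ is a Poisson process with intensity $\lambda>0$ and $(Z_i)_{i\ge1}$ are i.i.d. nonnegative random variables, independent of $N$, with $\mathsf{P}\{Z_1>0\}>0$. Equivalently, $\mathcal{I}^{(g)}_{[X]}=\sum_{k=0}^\infty g\bigl(\sum_{i=1}^kZ_i\bigr)E_{k+1}$, where $(E_k)_{k\ge1}$ are the i.i.d. exponential (rate $\lambda$) inter-arrival times of $N$. *)

(* Defs.v *)
From HB Require Import structures.
From mathcomp Require Import all_boot all_order all_algebra.
From mathcomp Require Import finmap complex.
From mathcomp Require Import all_classical all_reals all_analysis.
From mathcomp Require Import measurable_realfun.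

Set Implicit Arguments.
Unset Strict Implicit.
Unset Printing Implicit Defensive.

Import Order.TTheory GRing.Theory Num.Theory.
Import numFieldNormedType.Exports.

Local Open Scope classical_set_scope.
Local Open Scope ring_scope.
Local Open Scope complex_scope.

Section independence.
Context (d : measure_display) (T : measurableType d).
Context (R : realType) (P : probability T R).

Definition mutually_independent (d' : measure_display) (U : measurableType d')
    (I : choiceType) (X : I -> {RV P >-> U}) : Prop :=
  forall (J : {fset I}) (A : I -> set U), (forall i, measurable (A i)) ->
    P (\bigcap_(i in [set` J]) (X i @^-1` A i)) =
    (\prod_(i <- J) P (X i @^-1` A i))%E.

Definition identically_distributed (d' : measure_display)
    (U : measurableType d') (I : Type) (X : I -> {RV P >-> U}) : Prop :=
  forall i j (A : set U), measurable A ->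
    distribution P (X i) A = distribution P (X j) A.

Definition generated_salgebra (d' : measure_display) (U : measurableType d')
    (I : Type) (D : set I) (X : I -> {RV P >-> U}) : set (set T) :=
  <<s \bigcup_(i in D) preimage_set_system setT (X i) measurable >>.

Definition independent_salgebras (F G : set (set T)) : Prop :=
  forall A B, F A -> G B -> P (A `&` B) = (P A * P B)%E.

End independence.

Section processes.
Context (d : measure_display) (T : measurableType d).
Context (R : realType) (P : probability T R).

(* The variables written Y_1, Y_2, ... in the mathematics are Y 0, Y 1, ...,
   so that psum Y k is the sum of the first k of them; psum Y 0 = 0. *)
Definition psum (Y : nat -> {RV P >-> R}) (k : nat) (w : T) : R :=
  \sum_(i < k) Y i w.

(* The E k are the inter-arrival times and psum E n is the n-th arrival time;
   since E k >= 0, the last clause says that N t is the number of arrivals in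
   [0, t].  The values of N at negative times are irrelevant. *)
Definition poisson_process (lambda : R) (N : R -> {RV P >-> nat}) : Prop :=
  exists E : nat -> {RV P >-> R},
    [/\ mutually_independent E,
        forall k (A : set R), measurable A ->
          distribution P (E k) A = exponential_prob lambda A,
        forall k w, 0 <= E k w &
        forall t w, 0 <= t -> psum E (N t w) w <= t < psum E (N t w).+1 w].

Definition compound_process (N : R -> {RV P >-> nat})
    (Z : nat -> {RV P >-> R}) (t : R) (w : T) : R :=
  psum Z (N t w) w.

Definition path_integral (g : R -> R) (X : R -> T -> R) (w : T) : \bar R :=
  (\int[lebesgue_measure]_(t in `[0%R, +oo[) (g (X t w))%:E)%E.

(* Taking B = setT in the last clause and comparing with the normalization of
   f shows that Y lies in D, hence is finite, almost surely. *)
Definition has_density_on (D : set R) (Y : T -> \bar R) : Prop :=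
  measurable_fun [set: T] Y /\
  exists f : R -> R,
    [/\ measurable_fun D f,
        forall x, D x -> 0 <= f x,
        (\int[lebesgue_measure]_(x in D) (f x)%:E = 1)%E &
        forall B : set R, measurable B ->
          P (Y @^-1` (EFin @` B)) =
          (\int[lebesgue_measure]_(x in B `&` D) (f x)%:E)%E].

Definition cexp (z : R[i]) : R[i] :=
  (expR (complex.Re z))%:C *
  (cos (complex.Im z) +i* sin (complex.Im z)).

Definition cintegrable (f : T -> R[i]) : Prop :=
  P.-integrable setT (fun w => (complex.Re (f w))%:E) /\
  P.-integrable setT (fun w => (complex.Im (f w))%:E).

Definition cexpectation (f : T -> R[i]) : R[i] :=
  (\int[P]_w complex.Re (f w)) +i* (\int[P]_w complex.Im (f w)).

(* [fine] sends +oo to 0; it is only used for an almost surely finite Y. *)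
Definition laplace_integrand (Y : T -> \bar R) (u : R[i]) (w : T) : R[i] :=
  cexp (- u * (fine (Y w))%:C).

Definition laplace_transform (Y : T -> \bar R) (u : R[i]) : R[i] :=
  cexpectation (laplace_integrand Y u).

Definition laplace_product (lambda : R) (g : R -> R)
    (Z : nat -> {RV P >-> R}) (u : R[i]) (K : nat) (w : T) : R[i] :=
  \prod_(0 <= k < K.+1)
    (lambda%:C / (lambda%:C + (g (psum Z k w))%:C * u)).

End processes.

(* Main.v *)
Require Import Defs.
From HB Require Import structures.
From mathcomp Require Import all_boot all_order all_algebra.
From mathcomp Require Import finmap complex.
From mathcomp Require Import all_classical all_reals all_analysis.
From mathcomp Require Import measurable_realfun.
From mathcomp Require Import ring lra.

(** Write S_k = psum Z k for the random walk of the jumps, E_k for the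
    inter-arrival times and w_k = g(S_k).  The process sits at S_k during the
    time E_k, so pathwise the integral is the perpetuity I = sum_k w_k E_k
    ([path_integral_compound_process]).  The inter-arrival times are functions
    of the counting process ([arrivals_in_salgebra]); hence each E_k is
    independent of the sigma-algebra generated by all the jumps together with
    the other inter-arrival times ([others_indep]), and one E_k at a time can be
    integrated out ([ge0_integral_others], [integral_others]).

    Finiteness.  As E(w_k E_k) is a constant times E(w_k), it suffices that
    sum_k E(w_k) is finite, which makes I integrable.  Choose e > 0 such that
    p = P(Z_0 > e) > 0.  The tail sum h(x) = sum_j g(x + e j) is nonincreasing
    and h(x) - h(x + e) = g(x), so that p E(w_k) <= E(h(S_k)) - E(h(S_{k+1}))
    ([expected_weight_le]); these differences telescope and their sum is at most
    h(0), which is finite because the values of g at the integers are summable.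

    Density.  Since S_0 = 0, I is g(0) E_0 plus a nonnegative variable that is
    independent of E_0, and g(0) > 0; the conditional density of such a sum
    given its second term, averaged over that term, is a density of the sum
    ([convolution_densityP]).

    Jumps larger than delta.  Then w_k <= g(delta k) almost surely.  For
    0 <= c < lambda / g(0), integrating out the E_k bounds the expectation of
    exp(c I) by the product of the lambda / (lambda - c g(delta k)), which
    converges with the sum of the g(delta k)
    ([partial_perpetuity_mgf_bounded]).  This gives the moments, the
    integrability of exp(-u I) for Re u > - lambda / g(0), and a dominating
    function.  Integrating out E_m replaces the factor exp(-u w_m E_m) by
    lambda / (lambda + u w_m) ([hybrid_peel]), so the expectation of the product
    up to K equals that of exp(-u (w_0 E_0 + ... + w_K E_K)), and dominated
    convergence concludes ([laplace_product_cvg]). *)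

Set Implicit Arguments.
Unset Strict Implicit.
Unset Printing Implicit Defensive.

Import Order.TTheory GRing.Theory Num.Theory.
Import numFieldNormedType.Exports.

Local Open Scope classical_set_scope.
Local Open Scope ring_scope.

(** * Path integrals of piecewise constant processes *)

Section jump_times.
Context (R : realType) (s : nat -> R) (n : R -> nat).
Hypothesis s0 : s 0%N = 0.
Hypothesis s_ndecr : forall k, s k <= s k.+1.
Hypothesis s_n : forall t, 0 <= t -> s (n t) <= t < s (n t).+1.

Let s_homo (i j : nat) : (i <= j)%N -> s i <= s j.
Proof. by apply: (@homo_leq _ s <=%R); [exact: lexx|exact: le_trans|]. Qed.

Lemma jump_countE (k : nat) t : s k <= t < s k.+1 -> n t = k.
Proof.
move=> /andP[skt tsk].
have t0 : 0 <= t by rewrite (le_trans _ skt)// -s0 s_homo.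
have /andP[snt tsn] := s_n t0.
have [nk|kn|//] := ltngtP (n t) k.
  by have := lt_le_trans tsn (le_trans (s_homo nk) skt); rewrite ltxx.
by have := le_lt_trans (le_trans (s_homo kn) snt) tsk; rewrite ltxx.
Qed.

Lemma bigcup_jump_itv :
  \bigcup_k `[s k, s k.+1[%classic = `[0, +oo[%classic :> set R.
Proof.
apply/seteqP; split => t /=.
  move=> [k _] /=; rewrite !in_itv/= andbT => /andP[skt _].
  by rewrite (le_trans _ skt)// -s0 s_homo.
rewrite in_itv/= andbT => t0; exists (n t) => //=.
by rewrite in_itv/=; exact: s_n.
Qed.

(** [s] are the jump times and [n] the number of jumps: the integrand is the
    constant [c k] on the interval between two consecutive jump times. *)
Lemma integral_jump_count (c : nat -> R) : (forall k, 0 <= c k) ->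
  (\int[lebesgue_measure]_(t in `[0%R, +oo[) (c (n t))%:E =
   \sum_(0 <= k <oo) (c k * (s k.+1 - s k))%:E)%E.
Proof.
move=> c0; rewrite -bigcup_jump_itv.
have cE k : {in `[s k, s k.+1[%classic, (fun t => (c (n t))%:E) =1 cst (c k)%:E}.
  by move=> t; rewrite inE/= in_itv/= => /jump_countE ->.
rewrite ge0_integral_bigcup//.
- apply: eq_eseriesr => k _.
  transitivity (\int[lebesgue_measure]_(t in `[s k, s k.+1[) (cst (c k)%:E t))%E.
    by apply: eq_integral => t /cE.
  rewrite integral_cst//= lebesgue_measure_itv/= lte_fin.
  case: ifPn => [_|]; first by rewrite EFinM EFinB.
  rewrite -leNgt => sk; have -> : s k.+1 = s k by apply/le_anti; rewrite sk s_ndecr.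
  by rewrite subrr mulr0 mule0.
- apply/measurable_fun_bigcup => // k.
  by apply: (eq_measurable_fun (cst (c k)%:E)) => // t /cE ->.
- by move=> t _; rewrite lee_fin.
- apply/trivIsetP => i j _ _ ij; apply/seteqP; split => // t [] /=.
  rewrite !in_itv/= => /jump_countE ni /jump_countE nj.
  by move: ij; rewrite -ni -nj eqxx.
Qed.

End jump_times.

(** * Affine changes of variable *)

(** Lebesgue measure is characterized by its values on intervals, so it is [a]
    times its image under [y |-> a * y + b]. *)
Lemma ge0_integral_affine (R : realType) (f : R -> \bar R) (a b : R) :
  0 < a -> measurable_fun setT f -> (forall x, 0 <= f x)%E ->
  (\int[lebesgue_measure]_x f x =
   a%:E * \int[lebesgue_measure]_y f (a * y + b)%R)%E.
Proof.
move=> a0 mf f0.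
pose phi (y : measurableTypeR R) : measurableTypeR R := a * y + b.
have mphi : measurable_fun setT phi.
  by apply: measurable_funD => //; exact: mulrl_measurable.
pose k : {nonneg R} := NngNum (ltW a0).
pose nu0 : {measure set (measurableTypeR R) -> \bar R} :=
  mscale k (pushforward (@lebesgue_measure R) phi).
pose nu := nu0 mphi.
have nuE : forall A, measurable A -> lebesgue_measure A = nu A.
  apply: lebesgue_measure_unique => _ [[x y]] /= xy <-.
  rewrite /nu /nu0 /mscale/= /pushforward/=.
  rewrite (_ : phi @^-1` _ = `](x - b) / a, (y - b) / a]%classic); last first.
    apply/seteqP; split => z /=; rewrite !in_itv/= /phi ltr_pdivrMr// ler_pdivlMr//;
      by rewrite ltrBlDr lerBrDr (mulrC z).
  rewrite !lebesgue_measure_itv/= !lte_fin ltr_pM2r ?invr_gt0// ltrBlDr subrK.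
  case: ifPn => _; last by rewrite mule0.
  by rewrite -!EFinB -EFinM; congr _%:E; field; rewrite gt_eqF.
rewrite (eq_measure_integral nu); last by move=> A mA _; exact: nuE.
rewrite ge0_integral_mscale//; congr (_ * _)%E.
by rewrite ge0_integral_pushforward.
Qed.

(** * Integration against the exponential distribution *)

Section exponential.
Context {R : realType}.
Local Notation mu := (@lebesgue_measure R).

Lemma exponential_prob_dom (l : R) : exponential_prob l `<< mu.
Proof.
apply/null_content_dominatesP => A mA A0.
rewrite /exponential_prob null_set_integral//.
apply/measurable_funTS/measurableT_comp => //.
exact: measurable_exponential_pdf.
Qed.

Variables (l : R) (nu : probability (measurableTypeR R) R).
Hypothesis nuE : forall A : set R, measurable A -> nu A = exponential_prob l A.

(** The half-line is open at [0]: this way the conditional density of a sum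
    vanishes on the whole of the nonpositive half-line. *)
Lemma ge0_integral_exponential_leb (f : R -> \bar R) :
  measurable_fun setT f -> (forall x, 0 <= f x)%E ->
  (\int[nu]_x f x =
   \int[mu]_(x in `]0%R, +oo[) (f x * (l * expR (- l * x))%:E))%E.
Proof.
move=> mf f0.
have numu : nu `<< mu.
  apply/null_content_dominatesP => A mA A0; rewrite nuE//.
  by have /null_content_dominatesP := @exponential_prob_dom l; apply.
have mpdf : measurable_fun setT (fun x : R => (exponential_pdf l x)%:E).
  by apply/measurable_EFinP; exact: measurable_exponential_pdf.
have RNint := Radon_Nikodym_SigmaFinite.f_integrable numu.
rewrite -(Radon_Nikodym_SigmaFinite.change_of_variables numu)//.
transitivity (\int[mu]_x (f x * (exponential_pdf l x)%:E))%E.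
  apply: ae_eq_integral => //.
  - by apply: emeasurable_funM => //; exact: measurable_int RNint.
  - exact: emeasurable_funM.
  - apply: ae_eqe_mul2l; apply: integral_ae_eq => //.
    by move=> E _ mE; rewrite -Radon_Nikodym_SigmaFinite.f_integral//; exact: nuE.
rewrite integral_itv_obnd_cbnd; last first.
  apply: measurable_funTS; apply: emeasurable_funM => //.
  apply/measurable_EFinP; apply: measurable_funM => //.
  by apply: measurableT_comp => //; exact: mulrl_measurable.
rewrite [RHS]integral_mkcond; apply: eq_integral => x _.
rewrite patchE mem_setE in_itv/= andbT; case: leP => x0.
  by rewrite exponential_pdfE.
by rewrite lt0_exponential_pdf// mule0.
Qed.

End exponential.

Section exponential_law.
Context {R : realType} (l : R) (nu : probability R R).
Hypothesis nuE : forall A : set R, measurable A -> nu A = exponential_prob l A.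

(* Lebesgue measure and the laws of real random variables live on two copies
   of the Borel space of [R], identified by this map. *)
Let idR : R -> measurableTypeR R := idfun.
Let m_idR : measurable_fun setT idR.
Proof. by move=> _ B mB; rewrite setTI. Qed.
HB.instance Definition _ := isMeasurableFun.Build _ _ _ _ idR m_idR.

Lemma ge0_integral_exponential (f : R -> \bar R) :
  measurable_fun setT f -> (forall x, 0 <= f x)%E ->
  (\int[nu]_x f x =
   \int[lebesgue_measure]_(x in `]0%R, +oo[) (f x * (l * expR (- l * x))%:E))%E.
Proof.
move=> mf f0.
rewrite -(@ge0_integral_exponential_leb _ _ (distribution nu idR))//.
by rewrite ge0_integral_distribution.
Qed.

End exponential_law.

(** Taking [c >= |p| + |q|] makes the integrand nonnegative, so that the
    fundamental theorem of calculus on a half-line applies; the oscillating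
    integrals are then obtained as differences of two such integrals. *)
Lemma integral_expR_trig (R : realType) (al be c p q : R) :
  0 < al -> `|p| + `|q| <= c ->
  (\int[lebesgue_measure]_(x in `[0%R, +oo[)
    (expR (- al * x) * (c + p * cos (be * x) + q * sin (be * x)))%:E =
  (c / al + (al * p + be * q) / (al ^+ 2 + be ^+ 2))%:E)%E.
Proof.
move=> al0 pqc.
have D0 : al ^+ 2 + be ^+ 2 != 0.
  by rewrite gt_eqF// ltr_wpDr ?sqr_ge0// exprn_gt0.
(* [A] and [B] solve [al * A - be * B = p] and [al * B + be * A = q], which
   makes [F] an antiderivative of [f]. *)
pose A := (al * p + be * q) / (al ^+ 2 + be ^+ 2).
pose B := (al * q - be * p) / (al ^+ 2 + be ^+ 2).
pose f x := expR (- al * x) * (c + p * cos (be * x) + q * sin (be * x)).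
pose F x := - (expR (- al * x) * (c / al + A * cos (be * x) + B * sin (be * x))).
have dF (x : R) : is_derive x 1 F (f x).
  rewrite /F /f; apply: is_derive_eq.
  rewrite /GRing.scale/=.
  have cE : c = al * (c / al) by rewrite mulrCA mulfV ?mulr1// gt_eqF.
  have pE : p = al * A - be * B by rewrite /A /B; field.
  have qE : q = al * B + be * A by rewrite /A /B; field.
  by rewrite [in RHS]cE [in RHS]pE [in RHS]qE; ring.
have cF : continuous F by move=> x; exact/differentiable_continuous/derivable1_diffP.
have cf : continuous f.
  move=> x; apply/differentiable_continuous/derivable1_diffP.
  have df : exists y, is_derive x 1 f y by eexists; rewrite /f; typeclasses eauto.
  by case: df => y dfy; exact: (@ex_derive _ _ _ _ _ _ _ dfy).
pose K := `|c / al| + `|A| + `|B|.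
have expr_cvg0 (k : R) : k * expR (- al * x) @[x --> +oo] --> 0.
  rewrite -[X in _ --> X](mulr0 k); apply: cvgMr.
  rewrite (_ : (fun x => expR (- al * x)) =
               (fun z => expR (- z)) \o (fun z => al * z)); last first.
    by apply: eq_fun => x; rewrite mulNr.
  apply: (@cvg_comp _ _ _ _ _ _ (pinfty_nbhs R)); last exact: cvgr_expR.
  exact: gt0_cvgMry.
have F_cvg0 : F x @[x --> +oo] --> 0.
  apply: (@squeeze_cvgr _ _ _ _ (fun x => - K * expR (- al * x))
                                (fun x => K * expR (- al * x))) => //.
  apply: nearW => x; rewrite mulNr -ler_norml /F normrN normrM.
  rewrite ger0_norm ?expR_ge0// mulrC ler_wpM2r ?expR_ge0//.
  rewrite (le_trans (ler_normD _ _))// lerD//; last first.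
    by rewrite normrM ler_piMr// sin_max.
  rewrite (le_trans (ler_normD _ _))// lerD//.
  by rewrite normrM ler_piMr// cos_max.
rewrite (@ge0_continuous_FTC2y _ f F 0 0)//.
- by rewrite /F !mulr0 expR0 cos0 sin0 !mulr1 mulr0 addr0 mul1r sub0e EFinN oppeK EFinD.
- move=> x _; rewrite /f mulr_ge0 ?expR_ge0// -addrA -lerBlDl sub0r.
  apply: le_trans (_ : - (`|p| + `|q|) <= _); first by rewrite lerN2.
  suff : `|p * cos (be * x) + q * sin (be * x)| <= `|p| + `|q|.
    by rewrite ler_norml => /andP[].
  rewrite (le_trans (ler_normD _ _))// lerD// normrM ler_piMr//.
    exact: cos_max.
  exact: sin_max.
- exact: continuous_subspaceT.
- by apply: cvg_at_right_filter; exact: cF.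
- by move=> x _; rewrite derive1E; exact: (@derive_val _ _ _ _ _ _ _ (dF x)).
Qed.

(** * Independence *)

Section independence.
Context d (T : measurableType d) (R : realType) (P : probability T R).

(** A family of sets whose sigma-algebra is the information carried by [C] and
    by all the variables [X i] except [X k]. *)
Definition others_generator d' (U : measurableType d') (I : choiceType)
    (X : I -> {RV P >-> U}) (C : set (set T)) (k : I) : set (set T) :=
  C `|` \bigcup_(i in [set i | i != k]) preimage_set_system setT (X i) measurable.

Section cylinders.
Context d' (U : measurableType d') (I : choiceType) (X : I -> {RV P >-> U}).

Lemma generated_salgebra_preimage (D : set I) i B : D i -> measurable B ->
  generated_salgebra D X (X i @^-1` B).
Proof.
move=> Di mB; apply: sub_sigma_algebra; exists i => //.
by exists B => //; rewrite setTI.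
Qed.

Lemma generated_salgebra_measurable (D : set I) :
  generated_salgebra D X `<=` measurable.
Proof.
apply: smallest_sub; first exact: sigma_algebra_measurable.
by move=> _ [i _ [B mB <-]]; exact: measurable_funP.
Qed.

Variables (C : set (set T)).
Hypothesis X_indep : mutually_independent X.
Hypothesis C_alg : sigma_algebra setT C.
Hypothesis C_meas : C `<=` measurable.
Hypothesis XC_indep : independent_salgebras P (generated_salgebra setT X) C.

Let CT : C setT.
Proof.
have := @measurableT _ (g_sigma_algebraType C).
by rewrite /measurable/= sigma_algebra_id.
Qed.

Let CI : setI_closed C.
Proof.
move=> A B; have := @measurableI _ (g_sigma_algebraType C) A B.
by rewrite /measurable/= sigma_algebra_id.
Qed.

Lemma others_generator_measurable k : others_generator X C k `<=` measurable.
Proof.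
move=> B [/C_meas//|[i _ [A mA <-]]]; exact: measurable_funP.
Qed.

(** The events depending on [C] and finitely many [X i] with [i != k].  Letting
    [A i] be the full space outside [J] makes the intersection of two cylinders
    a cylinder, with no case analysis on the two index sets. *)
Definition cylinders (k : I) : set (set T) :=
  [set B | exists (J : {fset I}) (A : I -> set U) (H : set T),
    [/\ k \notin J, (forall i, measurable (A i)),
        (forall i, i \notin J -> A i = setT), C H &
        B = H `&` \bigcap_i (X i @^-1` A i)]].

Lemma bigcap_cylinder (J : {fset I}) (A : I -> set U) :
  (forall i, i \notin J -> A i = setT) ->
  \bigcap_i (X i @^-1` A i) = \bigcap_(i in [set` J]) (X i @^-1` A i).
Proof.
move=> AJ; apply/seteqP; split => [w Aw i _|w Aw i _ /=]; first exact: Aw.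
by case: (boolP (i \in J)) => [iJ|/AJ ->//]; exact: Aw.
Qed.

Lemma cylinder_in_salgebra (J : {fset I}) (A : I -> set U) :
  (forall i, measurable (A i)) ->
  generated_salgebra setT X (\bigcap_(i in [set` J]) (X i @^-1` A i)).
Proof.
move=> mA.
pose GX := g_sigma_algebraType
  (\bigcup_(i in setT) preimage_set_system setT (X i) measurable).
apply: (@fin_bigcap_measurable _ GX) => // i _.
exact: generated_salgebra_preimage.
Qed.

Lemma setI_closed_cylinders k : setI_closed (cylinders k).
Proof.
move=> _ _ [J1 [A1 [H1 [kJ1 mA1 AJ1 CH1 ->]]]] [J2 [A2 [H2 [kJ2 mA2 AJ2 CH2 ->]]]].
exists (J1 `|` J2)%fset, (fun i => A1 i `&` A2 i), (H1 `&` H2); split.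
- by rewrite inE negb_or kJ1 kJ2.
- by move=> i; exact: measurableI.
- by move=> i; rewrite inE negb_or => /andP[/AJ1 -> /AJ2 ->]; rewrite setIT.
- exact: CI.
- by rewrite setIACA -bigcapI.
Qed.

Lemma cylinder_salgebra k : <<s others_generator X C k >> `<=` <<s cylinders k >>.
Proof.
apply: smallest_sub; first exact: smallest_sigma_algebra.
move=> B [CB|[i /= ik [A mA <-]]]; apply: sub_sigma_algebra.
  exists fset0, (fun=> setT), B; split => //.
  by rewrite bigcapT ?setIT// => i _; rewrite preimage_setT.
exists [fset i]%fset, (fun j => if j == i then A else setT), setT; split => //.
- by rewrite inE eq_sym.
- by move=> j; case: ifP.
- by move=> j; rewrite inE => /negbTE ->.
- rewrite !setTI; apply/seteqP; split => w /=; last by move/(_ i Logic.I); rewrite eqxx.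
  by move=> Aw j _ /=; case: ifP => // /eqP ->.
Qed.

(** Adding the constraint [X k \in D] to a cylinder gives a cylinder with index
    set [k |` J], to which mutual independence applies. *)
Lemma cylinder_indep k (D : set U) B : measurable D -> cylinders k B ->
  P (B `&` X k @^-1` D) = (P B * P (X k @^-1` D))%E.
Proof.
move=> mD [J [A [H [kJ mA AJ CH ->]]]].
pose A' i := if i == k then D else A i.
have mA' i : measurable (A' i) by rewrite /A'; case: ifP.
have A'J i : i \notin (k |` J)%fset -> A' i = setT.
  by rewrite !inE negb_or /A' => /andP[/negbTE ->] /AJ.
have BE : (H `&` \bigcap_i (X i @^-1` A i)) `&` X k @^-1` D =
    (\bigcap_i (X i @^-1` A' i)) `&` H.
  rewrite -setIA setIC; congr (_ `&` _); apply/seteqP; split => w /=.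
    by move=> [Aw Dw] i _; rewrite /= /A'; case: ifP => [/eqP ->//|_]; exact: Aw.
  move=> A'w; split; last by have := A'w k Logic.I; rewrite /A' /= eqxx.
  move=> i _ /=; have := A'w i Logic.I; rewrite /A' /=; case: ifP => // /eqP -> _.
  by rewrite AJ.
rewrite BE [H `&` _]setIC (bigcap_cylinder AJ) (bigcap_cylinder A'J).
rewrite !XC_indep//; [|exact: cylinder_in_salgebra..].
rewrite !X_indep// big_fsetU1//= {1}/A' eqxx.
rewrite (eq_big_seq (fun i => P (X i @^-1` A i))).
  by rewrite -muleA muleC.
move=> i iJ; rewrite /A'; case: ifP => // /eqP ik.
by move: kJ; rewrite -ik iJ.
Qed.

(** For a fixed event [D] about [X k], the two sides of the product rule are
    finite measures in the other event, and they agree on the cylinders, which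
    are stable under intersection and generate. *)
Lemma others_indep k : independent_salgebras P <<s others_generator X C k >>
  (preimage_set_system setT (X k) measurable).
Proof.
move=> B _ /cylinder_salgebra sB [D mD <-]; rewrite setTI.
have mXD : measurable (X k @^-1` D) by exact: measurable_funPTI.
pose p : {nonneg R} := NngNum (fine_ge0 (measure_ge0 P (X k @^-1` D))).
have pE : (p%:num)%:E = P (X k @^-1` D) by rewrite /= fineK// fin_num_measure.
have cylm : cylinders k `<=` measurable.
  move=> _ [J [A [H [_ mA AJ /C_meas mH ->]]]].
  apply: measurableI => //; rewrite (bigcap_cylinder AJ).
  by apply: fin_bigcap_measurable => // i _; exact: measurable_funPTI.
rewrite muleC -pE.
apply: (g_sigma_algebra_measure_unique (cylinders k) cylm (fun=> setT) _ _
  (mrestr P mXD) (mscale p P)) => //.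
- move=> _; exists fset0, (fun=> setT), setT; split => //.
  by rewrite bigcapT ?setIT// => i _; rewrite preimage_setT.
- by rewrite bigcup_const.
- exact: setI_closed_cylinders.
- move=> B' cB'; transitivity ((p%:num)%:E * P B')%E; last by [].
  by rewrite pE muleC -cylinder_indep.
- move=> _; apply: le_lt_trans (ltry 1); apply: probability_le1.
  exact: measurableI.
Qed.

End cylinders.
End independence.

(** ** Integrating out an independent variable *)

Section integral_of_independent_pair.
Context d (T : measurableType d) (R : realType) (P : probability T R).
Context d1 (U : measurableType d1) d2 (V : measurableType d2).
Variables (X : {RV P >-> U}) (Y : {RV P >-> V}).
Hypothesis XY_indep : forall A B, measurable A -> measurable B ->
  P (X @^-1` A `&` Y @^-1` B) = (P (X @^-1` A) * P (Y @^-1` B))%E.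

Let XY w := (X w, Y w).
Let mXY : measurable_fun setT XY.
Proof. exact: measurable_fun_pair. Qed.
HB.instance Definition _ := isMeasurableFun.Build _ _ _ _ XY mXY.

(** By independence the joint law is a product measure, so the theorems of
    Tonelli and Fubini apply to it. *)
Let XY_law A : measurable A ->
  (distribution P X \x distribution P Y)%E A = distribution P XY A.
Proof.
apply: product_measure_unique => {}A B mA mB.
by rewrite /distribution /pushforward -XY_indep.
Qed.

Let XY_integral (f : U * V -> \bar R) :
  (\int[distribution P X \x distribution P Y]_z f z =
   \int[distribution P XY]_z f z)%E.
Proof. by apply: eq_measure_integral => A mA _; exact: XY_law. Qed.

Lemma ge0_integral_indep (h : U * V -> \bar R) :
  measurable_fun setT h -> (forall z, 0 <= h z)%E ->
  (\int[P]_w h (X w, Y w) = \int[P]_w \int[distribution P Y]_y h (X w, y))%E.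
Proof.
move=> mh h0.
rewrite -(ge0_integral_distribution XY mh h0).
rewrite -XY_integral.
rewrite fubini_tonelli1// ge0_integral_distribution//.
  exact: measurable_fun_fubini_tonelli_F.
by move=> x; apply: integral_ge0.
Qed.

Lemma integral_indep (h : U * V -> \bar R) :
  measurable_fun setT h -> P.-integrable setT (fun w => h (X w, Y w)) ->
  (\int[P]_w h (X w, Y w) = \int[P]_w \int[distribution P Y]_y h (X w, y))%E.
Proof.
move=> mh ih.
have ihXY : (distribution P X \x distribution P Y)%E.-integrable setT h.
  apply/integrableP; split => //.
  rewrite XY_integral.
  rewrite ge0_integral_distribution//; last exact: measurableT_comp.
  by have /integrableP[] := ih.
rewrite -(integral_distribution (X := XY))//.
rewrite -XY_integral.
rewrite -integral12_prod_meas1// integral_distribution//.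
  by apply: (measurable_int (distribution P X)); exact: integrable_fubini_F.
have := integrable_fubini_F ihXY.
move=> /integrableP[mF iF]; apply/integrableP; split.
  exact: measurableT_comp.
have := ge0_integral_distribution X (measurableT_comp (@abse_measurable R setT) mF).
move=> <-; [exact: iF|by move=> y; exact: abse_ge0].
Qed.

End integral_of_independent_pair.

Section adapted_variables.
Context d (T : measurableType d) (R : realType) (P : probability T R).
Context d' (U : measurableType d') (I : choiceType) (X : I -> {RV P >-> U}).
Variable C : set (set T).

Lemma measurable_fun_others k i : i != k ->
  measurable_fun setT (X i : g_sigma_algebraType (others_generator X C k) -> U).
Proof.
move=> ik _ B mB; rewrite setTI; apply: sub_sigma_algebra; right.
by exists i => //; exists B => //; rewrite setTI.
Qed.

Lemma measurable_fun_others_sub d1 (V : measurableType d1) (D : set (set T))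
    (f : T -> V) k : <<s D >> `<=` C ->
  measurable_fun setT (f : g_sigma_algebraType D -> V) ->
  measurable_fun setT (f : g_sigma_algebraType (others_generator X C k) -> V).
Proof.
move=> DC mf _ B mB; apply: sub_sigma_algebra; left; apply: DC.
exact: mf.
Qed.

Hypothesis X_indep : mutually_independent X.
Hypothesis C_alg : sigma_algebra setT C.
Hypothesis C_meas : C `<=` measurable.
Hypothesis XC_indep : independent_salgebras P (generated_salgebra setT X) C.

Lemma others_measurable_fun d1 (V : measurableType d1) (f : T -> V) k :
  measurable_fun setT (f : g_sigma_algebraType (others_generator X C k) -> V) ->
  measurable_fun setT f.
Proof.
move=> mf _ B mB; have := mf measurableT B mB; move: (_ `&` _).
apply: smallest_sub; first exact: sigma_algebra_measurable.
exact: (others_generator_measurable C_meas).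
Qed.

Lemma others_measurable_indep d1 (V : measurableType d1) (f : T -> V) k A B :
  measurable_fun setT (f : g_sigma_algebraType (others_generator X C k) -> V) ->
  measurable A -> measurable B ->
  P (f @^-1` A `&` X k @^-1` B) = (P (f @^-1` A) * P (X k @^-1` B))%E.
Proof.
move=> mf mA mB; apply: (others_indep X_indep C_alg C_meas XC_indep (k := k)).
  by rewrite -[f @^-1` A]setTI; exact: mf.
by exists B => //; rewrite setTI.
Qed.

Lemma ge0_integral_others d1 (V : measurableType d1) (f : T -> V) k
    (h : V * U -> \bar R) :
  measurable_fun setT (f : g_sigma_algebraType (others_generator X C k) -> V) ->
  measurable_fun setT h -> (forall z, 0 <= h z)%E ->
  (\int[P]_w h (f w, X k w) = \int[P]_w \int[distribution P (X k)]_y h (f w, y))%E.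
Proof.
move=> mf mh h0.
have mfT := others_measurable_fun mf.
pose f' : {RV P >-> V} := mfun_Sub (mem_set mfT).
rewrite (@ge0_integral_indep _ _ _ P _ _ _ _ f' (X k))// => A B mA mB.
exact: others_measurable_indep.
Qed.

Lemma integral_others d1 (V : measurableType d1) (f : T -> V) k
    (h : V * U -> \bar R) :
  measurable_fun setT (f : g_sigma_algebraType (others_generator X C k) -> V) ->
  measurable_fun setT h -> P.-integrable setT (fun w => h (f w, X k w)) ->
  (\int[P]_w h (f w, X k w) = \int[P]_w \int[distribution P (X k)]_y h (f w, y))%E.
Proof.
move=> mf mh ih.
have mfT := others_measurable_fun mf.
pose f' : {RV P >-> V} := mfun_Sub (mem_set mfT).
rewrite (@integral_indep _ _ _ P _ _ _ _ f' (X k))// => A B mA mB.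
exact: others_measurable_indep.
Qed.

End adapted_variables.

(** ** The inter-arrival times of a counting process *)

(** The first [n] arrivals have occurred by time [r] exactly when [n <= N r], so
    the arrival times, hence also the inter-arrival times, are functions of the
    counting process. *)
Lemma arrivals_in_salgebra d (T : measurableType d) (R : realType)
    (P : probability T R) (N : R -> {RV P >-> nat}) (E : nat -> {RV P >-> R}) :
  (forall k w, 0 <= E k w) ->
  (forall t w, 0 <= t -> psum E (N t w) w <= t < psum E (N t w).+1 w) ->
  generated_salgebra setT E `<=` generated_salgebra [set t : R | 0 <= t] N.
Proof.
move=> E0 EN.
pose GN := g_sigma_algebraType
  (\bigcup_(t in [set t : R | 0 <= t]) preimage_set_system setT (N t) measurable).
have psum_homo w i j : (i <= j)%N -> psum E i w <= psum E j w.
  apply: (@homo_leq _ (fun n => psum E n w) <=%R); [exact: lexx|exact: le_trans|].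
  by move=> n; rewrite /psum big_ord_recr/= lerDl.
have mS n : measurable_fun setT (psum E n : GN -> R).
  apply: (measurability _ (RGenOInfty.measurableE R)) => _ [_ [r ->] <-].
  rewrite setTI; have [r0|r0] := ltP r 0.
    rewrite (_ : _ @^-1` _ = setT); first exact: measurableT.
    apply/seteqP; split => // w _ /=; rewrite in_itv/= andbT.
    by rewrite (lt_le_trans r0)// sumr_ge0.
  apply: sub_sigma_algebra; exists r => //; exists [set m | (m < n)%N] => //.
  rewrite setTI; apply/seteqP; split => w /=; rewrite in_itv/= andbT.
    by move=> Nn; have /andP[_ /lt_le_trans] := EN r w r0; apply; exact: psum_homo.
  move=> rS; rewrite ltnNge; apply/negP => nN.
  have /andP[SN _] := EN r w r0.
  by have := lt_le_trans rS (le_trans (psum_homo w _ _ nN) SN); rewrite ltxx.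
have mE n : measurable_fun setT (E n : GN -> R).
  rewrite (_ : (E n : GN -> R) = (fun w => psum E n.+1 w - psum E n w)).
    exact: measurable_funB.
  by apply/funext => w; rewrite /psum big_ord_recr/= addrAC subrr add0r.
apply: smallest_sub; first exact: smallest_sigma_algebra.
by move=> _ [n _ [B mB <-]]; exact: mE.
Qed.

(** * Sampling a summable decreasing function along an arithmetic progression *)

Section decreasing_weight.
Context (R : realType) (g : R -> R).
Hypothesis g_ge0 : forall x, 0 <= x -> 0 <= g x.
Hypothesis g_decr : forall x y, 0 <= x -> x < y -> g y < g x.

Lemma weight_gt0 x : 0 <= x -> 0 < g x.
Proof.
move=> x0; apply: le_lt_trans (g_decr x0 (ltr_pwDr ltr01 (lexx x))).
by rewrite g_ge0// addr_ge0.
Qed.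

Lemma weight_nincr x y : 0 <= x -> x <= y -> g y <= g x.
Proof. by move=> x0; rewrite le_eqVlt => /predU1P[->//|/(g_decr x0)/ltW]. Qed.

(* [g] is arbitrary on the negative half-line, hence the truncation [Num.max]. *)
Lemma measurable_fun_weight d (T : measurableType d) (f : T -> R) :
  (forall w, 0 <= f w) -> measurable_fun setT f -> measurable_fun setT (g \o f).
Proof.
move=> f0 mf; rewrite (_ : g \o f = (fun x => g (Num.max x 0)) \o f); last first.
  by apply/funext => w /=; rewrite max_l.
apply: measurableT_comp mf; apply: nonincreasing_measurable => // x y xy.
apply: weight_nincr; first by rewrite le_max lexx orbT.
by rewrite ge_max !le_max xy lexx orbT.
Qed.

Hypothesis g_summable : cvgn (fun n : nat => \sum_(1 <= k < n) g k%:R).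

(** With [m >= 1 / e], the points [e * j] with [m * n <= j < m * (n + 1)] are all
    at least [n], so each block of [m] terms contributes at most [m * g n]. *)
Lemma weight_step_summable (e : R) : 0 < e ->
  (\sum_(0 <= j <oo) (g (e * j%:R))%:E < +oo)%E.
Proof.
move=> e0; pose m := (Num.truncn e^-1).+1.
have me : 1 <= e * m%:R.
  by rewrite mulrC -ler_pdivrMr// div1r ltW// truncnS_gt.
pose L := limn (fun n : nat => \sum_(1 <= k < n) g k%:R).
have g_le_lim n : \sum_(1 <= k < n) g k%:R <= L.
  apply: nondecreasing_cvgn_le => //; apply/nondecreasing_seqP => {}n.
  case: n => [|n]; first by rewrite !big_geq.
  by rewrite [leRHS]big_nat_recr//= lerDl g_ge0.
have block n : \sum_(0 <= j < m * n) g (e * j%:R) <=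
    m%:R * \sum_(0 <= i < n) g i%:R.
  elim: n => [|n IHn]; first by rewrite muln0 !big_geq// mulr0.
  rewrite mulnS addnC (big_cat_nat (leq0n _) (leq_addr _ _))//=.
  rewrite big_nat_recr//= mulrDr lerD//.
  rewrite (le_trans (ler_sum_nat (G := fun=> g n%:R) _))//.
    move=> j /andP[nj _]; apply: weight_nincr => //.
    rewrite (le_trans (ler_peMl (ler0n _ _) me))// -mulrA ler_pM2l//.
    by rewrite -natrM ler_nat.
  by rewrite sumr_const_nat addKn mulr_natl.
apply: le_lt_trans (ltry (m%:R * (g 0 + L))).
apply: lime_le.
  by apply: is_cvg_nneseries => j _ _; rewrite lee_fin g_ge0// mulr_ge0// ltW.
apply: nearW => n; rewrite sumEFin lee_fin.
apply: (@le_trans _ _ (\sum_(0 <= j < m * n) g (e * j%:R))).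
  rewrite [leRHS](@big_cat_nat _ _ _ n)//=; last by rewrite leq_pmull.
  by rewrite lerDl sumr_ge0// => j _; rewrite g_ge0// mulr_ge0// ltW.
apply: le_trans (block n) _; rewrite ler_wpM2l//.
case: n => [|n]; last first.
  by rewrite big_nat_recl//= lerD2l (le_trans _ (g_le_lim n.+1))// big_add1.
by rewrite big_geq// addr_ge0 ?g_ge0// (le_trans _ (g_le_lim 0%N))// big_geq.
Qed.

Definition tail_sum (e x : R) : \bar R :=
  (\sum_(0 <= j <oo) (g (x + e * j%:R))%:E)%E.

Lemma tail_sum_ge0 e x : 0 <= e -> 0 <= x -> (0 <= tail_sum e x)%E.
Proof.
move=> e0 x0; apply: nneseries_ge0 => j _ _.
by rewrite lee_fin g_ge0// addr_ge0// mulr_ge0.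
Qed.

Lemma tail_sum_nincr e x y : 0 <= e -> 0 <= x -> x <= y ->
  (tail_sum e y <= tail_sum e x)%E.
Proof.
move=> e0 x0 xy; apply: lee_nneseries => j _.
  by move=> _; rewrite lee_fin g_ge0// addr_ge0 ?mulr_ge0// (le_trans x0).
by rewrite lee_fin weight_nincr ?lerD2r// addr_ge0// mulr_ge0.
Qed.

Lemma tail_sumS e x : 0 <= e -> 0 <= x ->
  (tail_sum e x = (g x)%:E + tail_sum e (x + e))%E.
Proof.
move=> e0 x0; rewrite /tail_sum.
have gp j : (0 <= (g (x + e * j%:R))%:E)%E.
  by rewrite lee_fin g_ge0// addr_ge0// mulr_ge0.
rewrite nneseries_recl// mulr0 addr0 -nneseries_addn//.
congr (_ + _)%E; apply: eq_eseriesr => j _.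
by rewrite addn1 -natr1; congr (g _)%:E; ring.
Qed.

End decreasing_weight.

(** * Absolute continuity of an independent sum *)

Section exponential_convolution.
Context d (T : measurableType d) (R : realType) (P : probability T R).
Variables (l a : R) (Y : {RV P >-> R}) (W : {RV P >-> R}).
Hypothesis l_gt0 : 0 < l.
Hypothesis a_gt0 : 0 < a.
Hypothesis Y_law : forall A : set R, measurable A ->
  distribution P Y A = exponential_prob l A.
Hypothesis W_ge0 : forall w, 0 <= W w.
Hypothesis WY_indep : forall A B, measurable A -> measurable B ->
  P (W @^-1` A `&` Y @^-1` B) = (P (W @^-1` A) * P (Y @^-1` B))%E.

Let pdf (x : R) : R := \1_(`]0, +oo[%classic : set R) x * (l * expR (- l * x)).

Let pdf_ge0 x : 0 <= pdf x.
Proof. by rewrite mulr_ge0// ?indicE ?ler0n// mulr_ge0 ?expR_ge0// ltW. Qed.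

Let pdf_le x : pdf x <= l.
Proof.
rewrite /pdf indicE mem_setE in_itv/= andbT; case: ltP => x0; last by rewrite mul0r ltW.
by rewrite mul1r ler_piMr ?(ltW l_gt0)// -expR0 ler_expR mulNr oppr_le0 mulr_ge0// ltW.
Qed.

Let measurable_pdf : measurable_fun setT pdf.
Proof.
apply: measurable_funM; first exact: measurable_indic.
by apply: measurable_funM => //; apply: measurableT_comp => //.
Qed.

(* The conditional density at [x] of [a * Y + W], given the value [W w]. *)
Let q (w : T) (x : R) : R := a^-1 * pdf ((x - W w) / a).

Let q_ge0 w x : 0 <= q w x.
Proof. by rewrite mulr_ge0// invr_ge0 ltW. Qed.

Let measurable_q : measurable_fun setT (fun z : T * R => q z.1 z.2).
Proof.
apply: measurable_funM => //; apply: measurableT_comp => //.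
apply: measurable_funM => //; apply: measurable_funB => //.
exact: measurableT_comp.
Qed.

Definition convolution_density (x : R) : R := fine (\int[P]_w (q w x)%:E).

Lemma convolution_density_ge0 x : 0 <= convolution_density x.
Proof. by rewrite fine_ge0// integral_ge0// => w _; rewrite lee_fin. Qed.

Let densityE x : (convolution_density x)%:E = (\int[P]_w (q w x)%:E)%E.
Proof.
rewrite fineK// ge0_fin_numE; last by apply: integral_ge0 => w _; rewrite lee_fin.
apply: (@le_lt_trans _ _ (\int[P]_w (cst (a^-1 * l)%:E w))%E).
  apply: ge0_le_integral => //.
  - by move=> w _; rewrite lee_fin.
  - apply/measurable_EFinP.
    exact: (measurableT_comp measurable_q (measurable_pair2 _)).
  - by move=> w _; rewrite lee_fin ler_pM2l ?invr_gt0.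
by rewrite integral_cst//= probability_setT mule1 ltry.
Qed.

Lemma convolution_density0 x : x <= 0 -> convolution_density x = 0.
Proof.
move=> x0; apply: EFin_inj; rewrite densityE integral0_eq// => w _.
rewrite /q /pdf indicE mem_setE in_itv/= andbT; case: ltP => h.
  by move: h; rewrite pmulr_lgt0 ?invr_gt0// subr_gt0 ltNge (le_trans x0).
by rewrite mul0r mulr0.
Qed.

Lemma measurable_convolution_density : measurable_fun setT convolution_density.
Proof.
apply/measurable_EFinP.
rewrite (_ : EFin \o _ = fubini_G P (fun z : T * R => (q z.1 z.2)%:E)); last first.
  by apply/funext => x /=; rewrite densityE.
apply: measurable_fun_fubini_tonelli_G => [|z]; last by rewrite lee_fin.
exact/measurable_EFinP.
Qed.

(** Conditionally on the value of [W], the affine change of variable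
    [x = a * y + W w] turns the exponential density into [q w]; Tonelli's theorem
    then exchanges the expectation over [W] and the integral in [x]. *)
Lemma convolution_densityP (B : set R) : measurable B ->
  P [set w | B (a * Y w + W w)] =
  (\int[lebesgue_measure]_(x in B `&` [set x | (0 < x)%R])
     (convolution_density x)%:E)%E.
Proof.
move=> mB.
pose h (z : R * R) : \bar R := (\1_B (a * z.2 + z.1))%:E.
have mh : measurable_fun setT h.
  apply/measurable_EFinP; apply: measurableT_comp; first exact: measurable_indic.
  by apply: measurable_funD => //; apply: measurable_funM.
have h0 z : (0 <= h z)%E by rewrite lee_fin indicE ler0n.
have mS : measurable [set w | B (a * Y w + W w)].
  have mYW : measurable_fun setT (fun w => a * Y w + W w).
    by apply: measurable_funD => //; apply: measurable_funM.
  by rewrite -[X in measurable X]setTI; exact: mYW.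
transitivity (\int[P]_w h (W w, Y w))%E.
  transitivity (\int[P]_w (\1_[set w | B (a * Y w + W w)] w)%:E)%E.
    by rewrite integral_indic// setIT.
  apply: eq_integral => w _.
  by rewrite /h/= !indicE; congr ((_ : bool)%:R%:E); apply/idP/idP; rewrite !inE.
rewrite (ge0_integral_indep WY_indep mh h0).
transitivity (\int[P]_w \int[lebesgue_measure]_x (\1_B x * q w x)%:E)%E.
  apply: eq_integral => w _.
  rewrite (ge0_integral_exponential Y_law)//; last first.
    exact: (measurableT_comp mh (measurable_pair1 _)).
  have mBq : measurable_fun setT (fun x => (\1_B x * q w x)%:E).
    apply/measurable_EFinP; apply: measurable_funM; first exact: measurable_indic.
    exact: (measurableT_comp measurable_q (measurable_pair1 _)).
  have Bq0 x : (0 <= (\1_B x * q w x)%:E)%E by rewrite lee_fin mulr_ge0// indicE ler0n.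
  rewrite (@ge0_integral_affine _ _ a (W w))// -ge0_integralZl//; last 2 first.
  - by apply: (measurableT_comp mBq); apply: measurable_funD.
  - by rewrite lee_fin ltW.
  rewrite [LHS]integral_mkcond; apply: eq_integral => x _.
  have xE : (a * x + W w - W w) / a = x by rewrite addrK mulrAC mulfV ?mul1r// gt_eqF.
  rewrite patchE mem_setE in_itv/= andbT /h/= /q /pdf xE.
  rewrite [\1_(`]_, +oo[%classic) x]indicE mem_setE in_itv/= andbT.
  case: ltP => x0; last by rewrite mul0r !mulr0 mule0.
  rewrite -!EFinM; congr _%:E; rewrite mul1r.
  by field; rewrite gt_eqF.
rewrite (fubini_tonelli (m2 := lebesgue_measure)
  (fun z : T * R => (\1_B z.2 * q z.1 z.2)%:E))/=; last 2 first.
- apply/measurable_EFinP; apply: measurable_funM => //.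
  by apply: measurableT_comp; first exact: measurable_indic.
- by move=> z; rewrite lee_fin mulr_ge0// indicE ler0n.
rewrite [RHS]integral_mkcond; apply: eq_integral => x _.
rewrite patchE in_setI; under eq_integral do rewrite EFinM /=.
rewrite ge0_integralZl//; last 2 first.
- apply/measurable_EFinP.
  exact: (measurableT_comp measurable_q (measurable_pair2 _)).
- by move=> w _; rewrite lee_fin.
rewrite -densityE indicE; case: (x \in B) => /=; last by rewrite mul0e.
rewrite mul1e; case: ifPn => //; rewrite notin_setE/= => /negP; rewrite -leNgt.
by move=> /convolution_density0 ->.
Qed.

End exponential_convolution.

(** * Complex exponentials *)

Section complex_exponential.
Context {R : realType}.
Implicit Types z u F : R[i].

Lemma ReM z u : complex.Re (z * u) =
  complex.Re z * complex.Re u - complex.Im z * complex.Im u.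
Proof. by case: z u => [a b] [c e]. Qed.

Lemma ImM z u : complex.Im (z * u) =
  complex.Re z * complex.Im u + complex.Im z * complex.Re u.
Proof. by case: z u => [a b] [c e] /=. Qed.

Lemma normRe_le z : `|complex.Re z| <= Normc.normc z.
Proof.
by case: z => a b /=; rewrite -sqrtr_sqr ler_wsqrtr// lerDl sqr_ge0.
Qed.

Lemma normIm_le z : `|complex.Im z| <= Normc.normc z.
Proof.
by case: z => a b /=; rewrite -sqrtr_sqr ler_wsqrtr// lerDr sqr_ge0.
Qed.

Lemma normc_ge0 z : 0 <= Normc.normc z.
Proof. by case: z => a b /=; rewrite sqrtr_ge0. Qed.

Lemma normc_le z : Normc.normc z <= `|complex.Re z| + `|complex.Im z|.
Proof.
case: z => a b /=; rewrite -[leRHS]ger0_norm ?addr_ge0// -sqrtr_sqr.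
rewrite ler_wsqrtr// sqrrD !real_normK ?num_real// -addrA lerD2l lerDr.
by rewrite mulrn_wge0// mulr_ge0.
Qed.

Lemma normc_cexp z : Normc.normc (cexp z) = expR (complex.Re z).
Proof.
rewrite /cexp Normc.normcM /= expr0n/= addr0 sqrtr_sqr ger0_norm ?expR_ge0//.
by rewrite cos2Dsin2 sqrtr1 mulr1.
Qed.

Lemma cexp0 : cexp 0 = 1 :> R[i].
Proof. by rewrite /cexp/= expR0 cos0 sin0 mul1r. Qed.

Lemma cexpD z u : cexp (z + u) = cexp z * cexp u.
Proof.
case: z u => [a b] [c e]; rewrite /cexp/= expRD cosD sinD.
by apply/eqP; rewrite eq_complex/=; apply/andP; split; apply/eqP; ring.
Qed.

Lemma Re_mul_cexp F u (t : R) : complex.Re (F * cexp (- u * t%:C%C)) =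
  expR (- complex.Re u * t) * (complex.Re F * cos (complex.Im u * t) +
                               complex.Im F * sin (complex.Im u * t)).
Proof.
case: F u => [p q] [b c]; rewrite /cexp/=.
have -> : - b * t - - c * 0 = - b * t by ring.
have -> : - b * 0 + - c * t = - (c * t) by ring.
by rewrite cosN sinN; ring.
Qed.

Lemma Re_mul_laplace F u (l t : R) : 0 < l + t * complex.Re u ->
  complex.Re (F * (l%:C%C / (l%:C%C + t%:C%C * u))) =
  l * ((l + t * complex.Re u) * complex.Re F + t * complex.Im u * complex.Im F) /
  ((l + t * complex.Re u) ^+ 2 + (t * complex.Im u) ^+ 2).
Proof.
case: F u => [p q] [b c] /= h.
have D0 : (l + t * b) ^+ 2 + (t * c) ^+ 2 != 0.
  by rewrite gt_eqF// ltr_wpDr ?sqr_ge0// exprn_gt0.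
rewrite !(mul0r, subr0, add0r, addr0).
by field.
Qed.

(** The modulus of the denominator is at least its real part. *)
Lemma normc_laplace_le u (l a c : R) : 0 < l -> 0 <= c -> - c <= complex.Re u ->
  forall t, 0 <= t <= a -> c * a < l ->
  Normc.normc (l%:C%C / (l%:C%C + t%:C%C * u)) <= l / (l - c * a).
Proof.
move=> l0 c0 cu t /andP[t0 ta] cal.
have lc : 0 < l - c * a by rewrite subr_gt0.
have Re_ge : l - c * a <= complex.Re (l%:C%C + t%:C%C * u).
  case: u cu => b e /= cu; rewrite mul0r subr0 lerD2l -mulNr.
  apply: (@le_trans _ _ (- c * t)); first by rewrite !mulNr lerN2 ler_wpM2l.
  by rewrite [leRHS]mulrC ler_wpM2r.
rewrite Normc.normcM Normc.normcV.
rewrite (_ : Normc.normc l%:C%C = l); last first.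
  by rewrite /= expr0n/= addr0 sqrtr_sqr gtr0_norm.
rewrite ler_pM2l// lef_pV2 ?posrE//; last first.
  apply: lt_le_trans lc _; apply: le_trans Re_ge _.
  exact: le_trans (ler_norm _) (normRe_le _).
by apply: le_trans Re_ge _; exact: le_trans (ler_norm _) (normRe_le _).
Qed.

(** The real and imaginary parts are kept apart, as in [cintegrable]. *)
Definition cmeasurable d (T : measurableType d) (F : T -> R[i]) :=
  measurable_fun setT (fun w => complex.Re (F w)) /\
  measurable_fun setT (fun w => complex.Im (F w)).

Section cmeasurable.
Context d (T : measurableType d).
Implicit Types G H : T -> R[i].

Lemma cmeasurable_cst z : cmeasurable (fun _ : T => z).
Proof. by split; exact: measurable_cst. Qed.

Lemma cmeasurableM G H : cmeasurable G -> cmeasurable H ->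
  cmeasurable (fun w => G w * H w).
Proof.
move=> [rG iG] [rH iH]; split.
  rewrite (_ : (fun w => _) = fun w => complex.Re (G w) * complex.Re (H w) -
    complex.Im (G w) * complex.Im (H w)); last by apply/funext => w; rewrite ReM.
  by apply: measurable_funB; exact: measurable_funM.
rewrite (_ : (fun w => _) = fun w => complex.Re (G w) * complex.Im (H w) +
  complex.Im (G w) * complex.Re (H w)); last by apply/funext => w; rewrite ImM.
by apply: measurable_funD; exact: measurable_funM.
Qed.

Lemma cmeasurable_prod (I : Type) (s : seq I) (G : I -> T -> R[i]) :
  (forall i, cmeasurable (G i)) ->
  cmeasurable (fun w => \prod_(i <- s) G i w).
Proof.
move=> mG; elim: s => [|i s IHs].
  rewrite (_ : (fun w => _) = fun=> 1); first exact: cmeasurable_cst.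
  by apply/funext => w; rewrite big_nil.
rewrite (_ : (fun w => _) = fun w => G i w * \prod_(i <- s) G i w).
  exact: cmeasurableM.
by apply/funext => w; rewrite big_cons.
Qed.

Lemma cmeasurable_cexp u (f : T -> R) : measurable_fun setT f ->
  cmeasurable (fun w => cexp (- u * (f w)%:C%C)).
Proof.
move=> mf.
have mtrig (h : R -> R) (c : R) : continuous h ->
    measurable_fun setT (fun w => h (c * f w)).
  move=> ch; apply: measurableT_comp; first exact: continuous_measurable_fun.
  exact: measurable_funM.
have mexp : measurable_fun setT (fun w => expR (- complex.Re u * f w)).
  exact: (mtrig _ _ (@continuous_expR R)).
split.
  rewrite (_ : (fun w => _) = fun w => expR (- complex.Re u * f w) *
      cos (complex.Im u * f w)).
    by apply: measurable_funM => //; exact: (mtrig _ _ (@continuous_cos R)).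
  by apply/funext => w; rewrite -[cexp _]mul1r Re_mul_cexp/= mul1r mul0r addr0.
rewrite (_ : (fun w => _) = fun w => - (expR (- complex.Re u * f w) *
    sin (complex.Im u * f w))).
  apply/measurable_funN/measurable_funM => //.
  exact: (mtrig _ _ (@continuous_sin R)).
apply/funext => w; rewrite -[LHS]opprK -ReiNIm mulrC Re_mul_cexp/=.
by rewrite mul0r add0r mul1r.
Qed.

End cmeasurable.
End complex_exponential.

Lemma measurable_fun_inv d (T : measurableType d) (R : realType) (f : T -> R) :
  (forall w, 0 < f w) -> measurable_fun setT f ->
  measurable_fun setT (fun w => (f w)^-1).
Proof.
move=> f0 mf; rewrite (_ : (fun w => _) = fun w => expR (- ln (f w))).
  apply: measurableT_comp => //; apply: measurable_funN.
  exact: measurableT_comp.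
by apply/funext => w; rewrite expRN lnK// posrE.
Qed.

Lemma cmeasurable_laplace d (T : measurableType d) (R : realType) (u : R[i])
    (l : R) (f : T -> R) : measurable_fun setT f ->
  (forall w, 0 < l + f w * complex.Re u) ->
  cmeasurable (fun w => l%:C%C / (l%:C%C + (f w)%:C%C * u)).
Proof.
move=> mf f0.
pose al w := l + f w * complex.Re u; pose be w := f w * complex.Im u.
have mal : measurable_fun setT al.
  by apply: measurable_funD => //; exact: measurable_funM.
have mbe : measurable_fun setT be by exact: measurable_funM.
have mD : measurable_fun setT (fun w => (al w ^+ 2 + be w ^+ 2)^-1).
  apply: measurable_fun_inv => [w|].
    by rewrite ltr_wpDr ?sqr_ge0// exprn_gt0// f0.
  by apply: measurable_funD; exact: measurable_funX.
split.
  rewrite (_ : (fun w => _) = fun w => l * al w * (al w ^+ 2 + be w ^+ 2)^-1).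
    by apply: measurable_funM => //; exact: measurable_funM.
  apply/funext => w; rewrite -[X in complex.Re X]mul1r Re_mul_laplace//=.
  by rewrite mulr1 mulr0 addr0.
rewrite (_ : (fun w => _) = fun w => - (l * be w * (al w ^+ 2 + be w ^+ 2)^-1)).
  by apply: measurable_funN; apply: measurable_funM => //; exact: measurable_funM.
apply/funext => w; rewrite -[LHS]opprK -ReiNIm mulrC Re_mul_laplace//=.
by rewrite mulr1 mulr0 add0r.
Qed.

(** ** Laplace transform of the exponential distribution *)

Section exponential_laplace.
Context {R : realType} (l : R) (nu : probability R R).
Hypothesis l_gt0 : 0 < l.
Hypothesis nuE : forall A : set R, measurable A -> nu A = exponential_prob l A.

Let trig_bound (p q x : R) : `|p * cos x + q * sin x| <= `|p| + `|q|.
Proof.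
rewrite (le_trans (ler_normD _ _))// lerD// normrM ler_piMr//.
  exact: cos_max.
exact: sin_max.
Qed.

Let measurable_scaled (h : R -> R) (c : R) : continuous h ->
  measurable_fun setT (fun y => h (c * y)).
Proof.
move=> ch; apply: measurableT_comp; first exact: continuous_measurable_fun.
exact: mulrl_measurable.
Qed.

Let measurable_trig (b be c p q : R) : measurable_fun [set: R] (fun y : R =>
  expR (- b * y) * (c + p * cos (be * y) + q * sin (be * y))).
Proof.
have mc := measurable_scaled be (@continuous_cos R).
have ms := measurable_scaled be (@continuous_sin R).
have me := measurable_scaled (- b) (@continuous_expR R).
apply: measurable_funM => //; apply: measurable_funD; last exact: measurable_funM.
by apply: measurable_funD => //; exact: measurable_funM.
Qed.

Lemma integral_exponential_trig (b be c p q : R) :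
  0 < l + b -> `|p| + `|q| <= c ->
  (\int[nu]_y (expR (- b * y) * (c + p * cos (be * y) + q * sin (be * y)))%:E =
   (l * c / (l + b) +
    l * ((l + b) * p + be * q) / ((l + b) ^+ 2 + be ^+ 2))%:E)%E.
Proof.
move=> lb0 pqc.
rewrite (ge0_integral_exponential nuE)//; last 2 first.
- by apply/measurable_EFinP; apply: measurable_trig.
- move=> y; rewrite lee_fin mulr_ge0 ?expR_ge0// -addrA -lerBlDl sub0r.
  apply: le_trans (_ : - (`|p| + `|q|) <= _); first by rewrite lerN2.
  by have := trig_bound p q (be * y); rewrite ler_norml => /andP[].
transitivity (\int[lebesgue_measure]_(y in `]0%R, +oo[)
    (expR (- (l + b) * y) *
     (l * c + (l * p) * cos (be * y) + (l * q) * sin (be * y)))%:E)%E.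
  apply: eq_integral => y _; rewrite -EFinM; congr _%:E.
  have -> : - (l + b) * y = - b * y + - l * y by ring.
  by rewrite expRD; ring.
rewrite integral_itv_obnd_cbnd; last first.
  by apply/measurable_funTS/measurable_EFinP; exact: measurable_trig.
rewrite integral_expR_trig//; first by congr (_ + _ / _)%:E; ring.
by rewrite !normrM (gtr0_norm l_gt0) -mulrDr ler_pM2l.
Qed.

Lemma integral_exponential_expR (s : R) : s < l ->
  (\int[nu]_y (expR (s * y))%:E = (l / (l - s))%:E)%E.
Proof.
move=> sl; have h : 0 < l + - s by rewrite subr_gt0.
have /= := @integral_exponential_trig (- s) 0 1 0 0 h.
rewrite !normr0 addr0 => /(_ ler01).
rewrite !mulr0 addr0 mulr0 mul0r addr0 mulr1 => <-.
by apply: eq_integral => y _; rewrite opprK !mul0r !addr0 mulr1.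
Qed.

(** The integrand is dominated by [c * expR (- b * y)], where [b = t * Re u] and
    [c = `|Re F| + `|Im F|]; its sum with this bound is the nonnegative integrand
    of [integral_exponential_trig], and the bound is then subtracted. *)
Lemma integral_exponential_cexp (F u : R[i]) (t : R) :
  0 < l + t * complex.Re u ->
  (\int[nu]_y (complex.Re (F * cexp (- u * (t * y)%:C%C)))%:E =
   (complex.Re (F * (l%:C%C / (l%:C%C + t%:C%C * u))))%:E)%E.
Proof.
move=> h.
pose b := t * complex.Re u; pose be := t * complex.Im u.
pose p := complex.Re F; pose q := complex.Im F; pose c := `|p| + `|q|.
pose f1 y := expR (- b * y) * (c + p * cos (be * y) + q * sin (be * y)).
pose f2 y := expR (- b * y) * (c + 0 * cos (be * y) + 0 * sin (be * y)).
have I1 := @integral_exponential_trig b be c p q h (lexx _).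
have c0 : `|0 : R| + `|0 : R| <= c by rewrite normr0 addr0 addr_ge0.
have I2 := @integral_exponential_trig b be c 0 0 h c0.
have int1 (f : R -> R) (r : R) : measurable_fun setT f -> (forall y, 0 <= f y) ->
    (\int[nu]_y (f y)%:E = r%:E)%E -> nu.-integrable setT (EFin \o f).
  move=> mf f0 fr; apply/integrableP; split; first exact/measurable_EFinP.
  under eq_integral do rewrite /= ger0_norm//.
  by rewrite fr ltry.
have f10 y : 0 <= f1 y.
  rewrite mulr_ge0 ?expR_ge0// -addrA -lerBlDl sub0r.
  by have := trig_bound p q (be * y); rewrite ler_norml => /andP[].
have f20 y : 0 <= f2 y by rewrite mulr_ge0 ?expR_ge0// !mul0r !addr0 addr_ge0.
transitivity (\int[nu]_y ((f1 y)%:E - (f2 y)%:E))%E.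
  apply: eq_integral => y _; rewrite -EFinB Re_mul_cexp; congr _%:E.
  transitivity (expR (- b * y) * (p * cos (be * y) + q * sin (be * y))).
    by congr (expR _ * (_ * cos _ + _ * sin _)); rewrite /b /be; ring.
  by rewrite /f1 /f2; ring.
rewrite integralB//; [|exact: int1 I1|exact: int1 I2].
rewrite I1 I2 -EFinB Re_mul_laplace// !mulr0 addr0 mulr0 mul0r addr0 addrAC subrr.
by rewrite add0r.
Qed.

End exponential_laplace.

(** ** Convergence of complex sequences *)

Lemma cvg_complex (R : realType) (f : nat -> R[i]) (l : R[i]) :
  complex.Re (f n) @[n --> \oo] --> complex.Re l ->
  complex.Im (f n) @[n --> \oo] --> complex.Im l ->
  (f : nat -> R[i]^o) @ \oo --> (l : R[i]^o).
Proof.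
have ReB (z t : R[i]) : complex.Re (z - t) = complex.Re z - complex.Re t.
  by case: z t => [? ?] [? ?].
have ImB (z t : R[i]) : complex.Im (z - t) = complex.Im z - complex.Im t.
  by case: z t => [? ?] [? ?].
move=> /cvgrPdist_lt fr /cvgrPdist_lt fi; apply/cvgrPdist_lt => e e0.
have [er ei] : 0 < complex.Re e /\ complex.Im e = 0.
  by move: e0; rewrite ltcE/= => /andP[/eqP -> ->].
near=> n.
rewrite (_ : e = (complex.Re e)%:C%C); last by apply/eqP; rewrite eq_complex/= ei !eqxx.
have -> : `|l - f n| = (Normc.normc (l - f n))%:C%C by [].
rewrite ltcR; apply: le_lt_trans (normc_le _) _.
rewrite [complex.Re e]splitr; apply: ltrD.
  by rewrite ReB; near: n; apply: fr; rewrite divr_gt0.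
by rewrite ImB; near: n; apply: fi; rewrite divr_gt0.
Unshelve. all: by end_near. Qed.

(** * The perpetuity *)

Section perpetuity.
Context d (T : measurableType d) (R : realType) (P : probability T R).
Variables (lambda : R) (E Z : nat -> {RV P >-> R}) (g : R -> R).
Hypothesis lambda_gt0 : 0 < lambda.
Hypothesis E_indep : mutually_independent E.
Hypothesis E_law : forall k (A : set R), measurable A ->
  distribution P (E k) A = exponential_prob lambda A.
Hypothesis E_ge0 : forall k w, 0 <= E k w.
Hypothesis Z_indep : mutually_independent Z.
Hypothesis Z_ident : identically_distributed Z.
Hypothesis Z_ge0 : forall i w, 0 <= Z i w.
Hypothesis EZ_indep : independent_salgebras P
  (generated_salgebra setT E) (generated_salgebra setT Z).
Hypothesis g_ge0 : forall x, 0 <= x -> 0 <= g x.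
Hypothesis g_decr : forall x y, 0 <= x -> x < y -> g y < g x.
Hypothesis g_summable : cvgn (fun n : nat => \sum_(1 <= k < n) g k%:R).

(* A function on [\E k] is measurable when it depends only on the jumps and on
   the inter-arrival times other than [E k]; similarly for [\Z k], with the
   roles of the two families exchanged. *)
Let sE := generated_salgebra setT E.
Let sZ := generated_salgebra setT Z.
Let sE_alg : sigma_algebra setT sE. Proof. exact: smallest_sigma_algebra. Qed.
Let sZ_alg : sigma_algebra setT sZ. Proof. exact: smallest_sigma_algebra. Qed.
Let sE_meas : sE `<=` measurable. Proof. exact: generated_salgebra_measurable. Qed.
Let sZ_meas : sZ `<=` measurable. Proof. exact: generated_salgebra_measurable. Qed.
Let ZE_indep : independent_salgebras P sZ sE.
Proof. by move=> A B ZA EB; rewrite setIC EZ_indep// muleC. Qed.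

Local Notation "'\E' k" := (g_sigma_algebraType (others_generator E sZ k))
  (at level 10, k at level 9).
Local Notation "'\Z' k" := (g_sigma_algebraType (others_generator Z sE k))
  (at level 10, k at level 9).

Definition weight (k : nat) (w : T) : R := g (psum Z k w).

Lemma psum_ge0 k w : 0 <= psum Z k w.
Proof. by rewrite /psum sumr_ge0. Qed.

Lemma weight_ge0 k w : 0 <= weight k w.
Proof. by rewrite /weight g_ge0// psum_ge0. Qed.

Lemma weight_le0 k w : weight k w <= g 0.
Proof. by rewrite /weight (weight_nincr g_decr)// psum_ge0. Qed.

Lemma measurable_fun_psum d' (T' : measurableType d') (f : T' -> T) n :
  (forall i, (i < n)%N -> measurable_fun setT (Z i \o f)) ->
  measurable_fun setT (psum Z n \o f).
Proof.
move=> mZ; rewrite (_ : psum Z n \o f = fun w => \sum_(i < n) Z i (f w))//.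
by apply: measurable_sum => i; exact: mZ.
Qed.

Lemma measurable_psum_E n k : measurable_fun setT (psum Z n : \E k -> R).
Proof.
apply: (measurable_fun_psum (f := id : \E k -> T)) => i _.
apply: (@measurable_fun_others_sub _ _ _ P _ _ _ E sZ _ _
  (\bigcup_(i in setT) preimage_set_system setT (Z i) measurable)) => //.
move=> _ B mB; rewrite setTI; exact: generated_salgebra_preimage.
Qed.

Lemma measurable_psum_Z n : measurable_fun setT (psum Z n : \Z n -> R).
Proof.
apply: (measurable_fun_psum (f := id : \Z n -> T)) => i ni.
by apply: measurable_fun_others; rewrite lt_eqF.
Qed.

Lemma measurable_weight_E n k : measurable_fun setT (weight n : \E k -> R).
Proof.
apply: (measurable_fun_weight g_decr (f := psum Z n : \E k -> R)).
  exact: psum_ge0.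
exact: measurable_psum_E.
Qed.

Lemma measurable_weight_Z n : measurable_fun setT (weight n : \Z n -> R).
Proof.
apply: (measurable_fun_weight g_decr (f := psum Z n : \Z n -> R)).
  exact: psum_ge0.
exact: measurable_psum_Z.
Qed.

Lemma measurable_weight n : measurable_fun setT (weight n).
Proof.
apply: (@others_measurable_fun _ _ _ P _ _ _ E sZ sZ_meas _ _ _ 0%N).
exact: measurable_weight_E.
Qed.

Definition perpetuity (w : T) : \bar R :=
  (\sum_(0 <= k <oo) (weight k w * E k w)%:E)%E.

Lemma perpetuity_ge0 w : (0 <= perpetuity w)%E.
Proof. by apply: nneseries_ge0 => k _ _; rewrite lee_fin mulr_ge0// weight_ge0. Qed.

Lemma measurable_term k : measurable_fun setT (fun w => weight k w * E k w).
Proof. by apply: measurable_funM => //; exact: measurable_weight. Qed.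

Lemma measurable_perpetuity : measurable_fun setT perpetuity.
Proof.
apply: ge0_emeasurable_sum => k *.
  by rewrite lee_fin mulr_ge0// weight_ge0.
by apply/measurable_EFinP; exact: measurable_term.
Qed.

(** ** Finiteness *)

(** [y <= (2 / lambda) * expR (lambda * y / 2)] for all [y], and the right-hand
    side is integrable. *)
Lemma exponential_mean_lty k : (\int[distribution P (E k)]_y `|y|%:E < +oo)%E.
Proof.
have mexp : measurable_fun [set: R] (fun y => (expR (lambda / 2 * y))%:E).
  apply/measurable_EFinP; apply: (measurableT_comp (measurable_expR (R := R))).
  exact: mulrl_measurable.
have mabs : measurable_fun [set: R] (fun y : R => `|y|%:E).
  by apply/measurable_EFinP; exact: normr_measurable.
rewrite ge0_integral_distribution//.
apply: (@le_lt_trans _ _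
    (\int[P]_w ((2 / lambda)%:E * (expR (lambda / 2 * E k w))%:E))%E).
  apply: ge0_le_integral => //.
  - by move=> w _; rewrite /= lee_fin.
  - exact: (measurableT_comp mabs).
  - by apply: emeasurable_funM => //; exact: (measurableT_comp mexp).
  - move=> w _; rewrite /= -EFinM lee_fin ger0_norm// mulrAC ler_pdivlMr//.
    by have := expR_ge1Dx (lambda / 2 * E k w); lra.
rewrite ge0_integralZl//; last 2 first.
- exact: (measurableT_comp mexp).
- by rewrite lee_fin divr_ge0// ltW.
have := ge0_integral_distribution (E k) mexp => /= <- //.
rewrite (integral_exponential_expR lambda_gt0 (E_law k)).
  by rewrite -EFinM ltry.
by have := lambda_gt0; lra.
Qed.

Lemma measurable_jump_gt i (e : R) : measurable [set w | e < Z i w].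
Proof.
rewrite (_ : [set w | _] = Z i @^-1` `]e, +oo[%classic).
  exact: measurable_funPTI.
by apply/seteqP; split => w /=; rewrite in_itv/= andbT.
Qed.

Lemma probability_jump_gt i (e : R) :
  P [set w | e < Z i w] = distribution P (Z i) `]e, +oo[%classic.
Proof.
rewrite /distribution /pushforward; congr (P _).
by apply/seteqP; split => w /=; rewrite in_itv/= andbT.
Qed.

Lemma jump_threshold : (0 < P [set w | (0 < Z 0%N w)%R])%E ->
  exists2 e : R, 0 < e & (0 < P [set w | (e < Z 0%N w)%R])%E.
Proof.
move=> Zpos; apply: contrapT => noe.
have Z_null (n : nat) : P [set w | n.+1%:R^-1 < Z 0%N w] = 0%E.
  apply/eqP; rewrite eq_le measure_ge0 andbT leNgt; apply/negP => Zn.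
  by apply: noe; exists n.+1%:R^-1.
have : P (\bigcup_n [set w | n.+1%:R^-1 < Z 0%N w]) = 0%E.
  apply/negligibleP.
    by apply: bigcup_measurable => n _; exact: measurable_jump_gt.
  apply: negligible_bigcup => n.
  by apply/(negligibleP _ (measurable_jump_gt _ _)); exact: Z_null.
rewrite (_ : \bigcup_n _ = [set w | 0 < Z 0%N w]) => [Z0|].
  by rewrite Z0 ltxx in Zpos.
apply/seteqP; split => w /=; first by move=> [n _] /=; exact: lt_trans.
by move=> Zw; have [n] := ltr_add_invr Zw; rewrite add0r; exists n.
Qed.

(** The tail sum [h] of [g] along the step [e] satisfies [h x = g x + h (x + e)]
    and is nonincreasing, so a jump of size more than [e] taken from the level
    [x] lowers [h] by at least [g x]; the next jump is independent of the present
    level. *)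
Lemma expected_weight_le (e : R) k : 0 < e ->
  (P [set w | (e < Z 0%N w)%R] * \int[P]_w (weight k w)%:E +
     \int[P]_w tail_sum g e (psum Z k.+1 w) <=
   \int[P]_w tail_sum g e (psum Z k w))%E.
Proof.
move=> e0; have eW := ltW e0.
have mtail n : measurable_fun setT (fun w => tail_sum g e (psum Z n w)).
  apply: ge0_emeasurable_sum => j *.
    by rewrite lee_fin g_ge0// addr_ge0 ?psum_ge0// mulr_ge0.
  apply/measurable_EFinP.
  apply: (measurable_fun_weight g_decr (f := fun w => psum Z n w + e * j%:R)).
    by move=> w; rewrite addr_ge0 ?psum_ge0// mulr_ge0.
  apply: measurable_funD => //.
  exact: (measurable_fun_psum (f := id)).
pose h (z : R * R) : \bar R := (`|z.1| * \1_(`]e, +oo[%classic) z.2)%:E.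
have mh : measurable_fun setT h.
  apply/measurable_EFinP; apply: measurable_funM.
    exact: measurableT_comp.
  exact: measurableT_comp.
have h0 z : (0 <= h z)%E by rewrite lee_fin mulr_ge0// ?indicE ?ler0n.
have hE : (P [set w | (e < Z 0%N w)%R] * \int[P]_w (weight k w)%:E =
    \int[P]_w h (weight k w, Z k w))%E.
  rewrite (ge0_integral_others Z_indep sE_alg sE_meas ZE_indep _ mh h0); last first.
    exact: measurable_weight_Z.
  rewrite -ge0_integralZl//; last 2 first.
  - exact/measurable_EFinP/measurable_weight.
  - by move=> w _; rewrite lee_fin weight_ge0.
  apply: eq_integral => w _.
  rewrite /h; under eq_integral do rewrite EFinM /=.
  rewrite ge0_integralZl//; last first.
    by apply/measurable_EFinP; exact: measurable_indic.
  rewrite integral_indic// setIT muleC ger0_norm ?weight_ge0//; congr (_ * _)%E.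
  by rewrite probability_jump_gt; exact: Z_ident.
have mhw : measurable_fun setT (fun w => h (weight k w, Z k w)).
  apply: (measurableT_comp mh); apply: measurable_fun_pair => //.
  exact: measurable_weight.
rewrite hE -ge0_integralD//; last first.
  by move=> w _; exact: tail_sum_ge0 (psum_ge0 _ _).
apply: ge0_le_integral => //.
- by move=> w _; rewrite adde_ge0// tail_sum_ge0// psum_ge0.
- exact: emeasurable_funD.
move=> w _; have psumS : psum Z k.+1 w = psum Z k w + Z k w.
  by rewrite /psum big_ord_recr.
rewrite /h/= indicE mem_setE in_itv/= andbT ger0_norm ?weight_ge0//.
have [Zk|Zk] := ltP e (Z k w).
  rewrite mulr1 [leRHS]tail_sumS ?psum_ge0// leeD2l//.
  by rewrite tail_sum_nincr ?addr_ge0 ?psum_ge0// psumS lerD2l ltW.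
by rewrite mulr0 add0e tail_sum_nincr ?psum_ge0// psumS lerDl.
Qed.

Lemma expected_weight_sum_le (e : R) n : 0 < e ->
  (P [set w | (e < Z 0%N w)%R] * \sum_(k < n) \int[P]_w (weight k w)%:E <=
   tail_sum g e 0)%E.
Proof.
move=> e0; have eW := ltW e0.
have int_ge0 k : (0 <= \int[P]_w (weight k w)%:E)%E.
  by apply: integral_ge0 => w _; rewrite lee_fin weight_ge0.
apply: (@le_trans _ _ (P [set w | (e < Z 0%N w)%R] *
    \sum_(k < n) \int[P]_w (weight k w)%:E +
    \int[P]_w tail_sum g e (psum Z n w))%E).
  by rewrite leeDl// integral_ge0// => w _; rewrite tail_sum_ge0// psum_ge0.
elim: n => [|n IHn].
  rewrite big_ord0 mule0 add0e (eq_integral (cst (tail_sum g e 0))); last first.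
    by move=> w _; rewrite /psum big_ord0.
  by rewrite integral_cst//= probability_setT mule1.
apply: le_trans IHn; rewrite big_ord_recr/= ge0_muleDr//; last exact: sume_ge0.
by rewrite -addeA leeD2l// expected_weight_le.
Qed.

Hypothesis Z_pos : (0 < P [set w | (0 < Z 0%N w)%R])%E.

Lemma perpetuity_mean_lty : (\int[P]_w perpetuity w < +oo)%E.
Proof.
have [e e0 Pe] := jump_threshold Z_pos.
set p := P _ in Pe.
have pfin : p \is a fin_num.
  by rewrite fin_num_measure//; exact: measurable_jump_gt.
have tail_lty : (tail_sum g e 0 < +oo)%E.
  have := weight_step_summable g_ge0 g_decr g_summable e0.
  by rewrite /tail_sum; under [in X in _ -> X]eq_eseriesr do rewrite add0r.
pose m := (\int[distribution P (E 0%N)]_y `|y|%:E)%E.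
have m_lty : (m < +oo)%E by exact: exponential_mean_lty.
have m_ge0 : (0 <= m)%E by apply: integral_ge0 => y _; rewrite lee_fin.
have mabs : measurable_fun [set: R] (fun y : R => `|y|%:E).
  by apply/measurable_EFinP; exact: normr_measurable.
have term_mean k : (\int[P]_w (weight k w * E k w)%:E =
    m * \int[P]_w (weight k w)%:E)%E.
  pose h (z : R * R) : \bar R := (`|z.1| * `|z.2|)%:E.
  have mh : measurable_fun setT h.
    by apply/measurable_EFinP; apply: measurable_funM; exact: measurableT_comp.
  have h0 z : (0 <= h z)%E by rewrite lee_fin mulr_ge0.
  transitivity (\int[P]_w h (weight k w, E k w))%E.
    by apply: eq_integral => w _; rewrite /h/= !ger0_norm ?weight_ge0.
  rewrite (ge0_integral_others E_indep sZ_alg sZ_meas EZ_indep _ mh h0); last first.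
    exact: measurable_weight_E.
  rewrite -ge0_integralZl//; last 2 first.
  - exact/measurable_EFinP/measurable_weight.
  - by move=> w _; rewrite lee_fin weight_ge0.
  apply: eq_integral => w _.
  rewrite /h; under eq_integral do rewrite EFinM /=.
  rewrite ge0_integralZl// muleC ger0_norm ?weight_ge0//; congr (_ * _)%E.
  apply: eq_measure_integral => A mA _.
  by transitivity (exponential_prob lambda A); [|apply: esym]; exact: E_law.
rewrite integral_nneseries//; last 2 first.
- by move=> k; apply/measurable_EFinP; exact: measurable_term.
- by move=> k w _; rewrite lee_fin mulr_ge0// weight_ge0.
under eq_eseriesr do rewrite term_mean.
have int_ge0 k : (0 <= \int[P]_w (weight k w)%:E)%E.
  by apply: integral_ge0 => w _; rewrite lee_fin weight_ge0.
have mE : m = (fine m)%:E by rewrite fineK// ge0_fin_numE.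
have pE : p = (fine p)%:E by rewrite fineK.
have p0 : 0 < fine p by rewrite -lte_fin -pE.
rewrite mE nneseriesZl//.
apply: (@le_lt_trans _ _ ((fine m)%:E * ((fine p)^-1%:E * tail_sum g e 0))%E).
  rewrite lee_wpmul2l ?lee_fin ?fine_ge0//; apply: lime_le.
    by apply: is_cvg_nneseries => k _ _.
  apply: nearW => n; rewrite big_mkord lee_pdivlMl// -pE.
  exact: expected_weight_sum_le.
apply: lte_mul_pinfty => //; first by rewrite lee_fin fine_ge0.
by apply: lte_mul_pinfty => //; rewrite lee_fin invr_ge0 ltW.
Qed.

Lemma perpetuity_ae_lty : {ae P, forall w, (perpetuity w < +oo)%E}.
Proof.
have iI : P.-integrable setT perpetuity.
  apply/integrableP; split; first exact: measurable_perpetuity.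
  under eq_integral do rewrite gee0_abs ?perpetuity_ge0//.
  exact: perpetuity_mean_lty.
apply: filterS (integrable_ae measurableT iI) => w /(_ Logic.I).
by rewrite ge0_fin_numE// perpetuity_ge0.
Qed.

(** ** Density *)

(** The sum is [+oo] on a null set at most, where [fine] replaces it by [0]; a
    real-valued variable is what [convolution_density] expects. *)
Definition later_terms (w : T) : R :=
  fine (\sum_(0 <= k <oo) (weight k.+1 w * E k.+1 w)%:E)%E.

Lemma later_terms_ge0 w : 0 <= later_terms w.
Proof.
apply: fine_ge0; apply: nneseries_ge0 => k _ _.
by rewrite lee_fin mulr_ge0// weight_ge0.
Qed.

Lemma measurable_later_terms : measurable_fun setT (later_terms : \E 0%N -> R).
Proof.
apply: (@measurableT_comp _ _ _ _ _ _ fine _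
  (fun w : \E 0%N => \sum_(0 <= k <oo) (weight k.+1 w * E k.+1 w)%:E)%E).
  exact: fine_measurable.
apply: ge0_emeasurable_sum => k *.
  by rewrite lee_fin mulr_ge0// weight_ge0.
apply/measurable_EFinP; apply: measurable_funM; first exact: measurable_weight_E.
exact: measurable_fun_others.
Qed.

Lemma perpetuity_first_term w : (perpetuity w < +oo)%E ->
  perpetuity w = (g 0 * E 0%N w + later_terms w)%:E.
Proof.
have t0 k : (0 <= (weight k w * E k w)%:E)%E by rewrite lee_fin mulr_ge0// weight_ge0.
have w0 : weight 0 w = g 0 by rewrite /weight /psum big_ord0.
rewrite /perpetuity nneseries_recl// -nneseries_addn// w0 EFinD.
under eq_eseriesr do rewrite addn1.
move=> Ilty; rewrite /later_terms fineK// ge0_fin_numE; last exact: nneseries_ge0.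
by apply: le_lt_trans Ilty; rewrite leeDr// -w0.
Qed.

Let later_terms_RV : {RV P >-> R} := mfun_Sub (mem_set
  (others_measurable_fun sZ_meas measurable_later_terms)).

Lemma perpetuity_has_density : has_density_on P [set x | 0 < x] perpetuity.
Proof.
split; first exact: measurable_perpetuity.
have g0 : 0 < g 0 by exact: weight_gt0.
pose f := convolution_density lambda (g 0) later_terms_RV.
have LE_indep A B : measurable A -> measurable B ->
    P (later_terms_RV @^-1` A `&` E 0%N @^-1` B) =
    (P (later_terms_RV @^-1` A) * P (E 0%N @^-1` B))%E.
  move=> mA mB.
  apply: (others_measurable_indep E_indep sZ_alg sZ_meas EZ_indep) mA mB.
  exact: measurable_later_terms.
have W_ge0 w : 0 <= later_terms_RV w by exact: later_terms_ge0.
have fP B : measurable B -> P (perpetuity @^-1` (EFin @` B)) =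
    (\int[lebesgue_measure]_(x in B `&` [set x | (0 < x)%R]) (f x)%:E)%E.
  move=> mB.
  rewrite -(convolution_densityP lambda_gt0 g0 (E_law 0%N) W_ge0 LE_indep mB).
  have mI : measurable (perpetuity @^-1` (EFin @` B)).
    rewrite -[X in measurable X]setTI; apply: measurable_perpetuity => //.
    by apply: measurable_image_EFin.
  have mS : measurable [set w | B (g 0 * E 0%N w + later_terms_RV w)].
    have mYW : measurable_fun setT (fun w => g 0 * E 0%N w + later_terms_RV w).
      by apply: measurable_funD => //; apply: measurable_funM.
    by rewrite -[X in measurable X]setTI; exact: mYW.
  rewrite -[in LHS](setIT (_ @^-1` _)) -integral_indic//.
  rewrite -[in RHS](setIT [set w | _]) -integral_indic//.
  apply: ae_eq_integral => //.
  - by apply/measurable_EFinP; apply: measurable_indic.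
  - by apply/measurable_EFinP; apply: measurable_indic.
  apply: filterS perpetuity_ae_lty => w /perpetuity_first_term Iw _.
  congr ((_ : bool)%:R%:E); apply/idP/idP; rewrite !inE/= Iw.
    by move=> [x Bx [<-]].
  by move=> Bx; exists (g 0 * E 0%N w + later_terms w).
exists f; split.
- by apply: measurable_funTS; apply: measurable_convolution_density.
- by move=> x _; apply: convolution_density_ge0.
- rewrite -[X in integral _ X]setTI -fP//.
  have mI : measurable (perpetuity @^-1` range EFin).
    rewrite -[X in measurable X]setTI; apply: measurable_perpetuity => //.
    exact: (measurable_image_EFin (@measurableT _ (measurableTypeR R))).
  rewrite -[LHS]mul1e -integral_cst//.
  transitivity (\int[P]_w cst 1%E w)%E; last first.
    by rewrite integral_cst//= probability_setT mul1e.
  rewrite integral_mkcond; apply: ae_eq_integral => //.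
    by apply/(measurable_restrictT _ mI).
  apply: filterS perpetuity_ae_lty => w Iw _; rewrite patchE mem_set//=.
  by exists (fine (perpetuity w)) => //; rewrite fineK// ge0_fin_numE// perpetuity_ge0.
- exact: fP.
Qed.

(** ** Exponential moments *)

Definition partial_perpetuity (n : nat) (w : T) : R :=
  \sum_(k < n) weight k w * E k w.

Lemma partial_perpetuity_ge0 n w : 0 <= partial_perpetuity n w.
Proof. by apply: sumr_ge0 => k _; rewrite mulr_ge0// weight_ge0. Qed.

Lemma partial_perpetuityS n w :
  partial_perpetuity n.+1 w = partial_perpetuity n w + weight n w * E n w.
Proof. by rewrite /partial_perpetuity big_ord_recr. Qed.

Lemma partial_perpetuity_cvg w :
  (partial_perpetuity n w)%:E @[n --> \oo] --> perpetuity w.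
Proof.
rewrite (_ : (fun n => _) = fun n => (\sum_(0 <= k < n) (weight k w * E k w)%:E)%E).
  by apply: is_cvg_nneseries => k _ _; rewrite lee_fin mulr_ge0// weight_ge0.
by apply/funext => n; rewrite sumEFin big_mkord.
Qed.

Lemma measurable_partial_perpetuity_E n k : (n <= k)%N ->
  measurable_fun setT (partial_perpetuity n : \E k -> R).
Proof.
move=> nk.
rewrite (_ : partial_perpetuity n = fun w => \sum_(i < n) weight i w * E i w)//.
apply: measurable_sum => i; apply: measurable_funM; first exact: measurable_weight_E.
by apply: measurable_fun_others; rewrite ltn_eqF// (leq_trans (ltn_ord i) nk).
Qed.

Lemma measurable_partial_perpetuity n : measurable_fun setT (partial_perpetuity n).
Proof.
apply: (others_measurable_fun (X := E) sZ_meas).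
exact: (measurable_partial_perpetuity_E (leqnn n)).
Qed.

Section bounded_away_jumps.
Variable delta : R.
Hypothesis delta_gt0 : 0 < delta.
Hypothesis Z_delta : P [set w | delta < Z 0%N w] = 1%E.

Lemma ae_weight_le : {ae P, forall w k, weight k w <= g (delta * k%:R)}.
Proof.
have mZ i := measurable_jump_gt i delta.
have Zi i : P [set w | delta < Z i w] = 1%E.
  by rewrite -Z_delta !probability_jump_gt; exact: Z_ident.
have ae_jump : {ae P, forall w i, delta < Z i w}.
  apply: ae_foralln => i.
  have ZiC : P (~` [set w | delta < Z i w]) = 0%E.
    by rewrite probability_setC// Zi subee.
  by exists (~` [set w | delta < Z i w]); split => //; exact: measurableC.
apply: filterS ae_jump => w Zw k; apply: weight_nincr => //.
  by rewrite mulr_ge0// ltW.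
rewrite /psum mulr_natr -[in leLHS](card_ord k) -sumr_const.
by apply: ler_sum => i _; exact/ltW.
Qed.

Section exponential_moment.
Variable c : R.
Hypothesis c_ge0 : 0 <= c.
Hypothesis c_lt : c * g 0 < lambda.

Let g_le x : 0 <= x -> c * g x <= c * g 0.
Proof. by move=> x0; rewrite ler_wpM2l// (weight_nincr g_decr). Qed.

Let rate_gt0 x : 0 <= x -> 0 < lambda - c * g x.
Proof. by move=> x0; rewrite subr_gt0 (le_lt_trans (g_le x0)). Qed.

Let mexpc n : measurable_fun setT (fun w => expR (c * partial_perpetuity n w)).
Proof.
apply: measurableT_comp => //; apply: measurable_funM => //.
exact: measurable_partial_perpetuity.
Qed.

(** Integrating out [E n] given the rest replaces [expR (c * weight n w * E n w)]
    by [lambda / (lambda - c * weight n w)], an increasing function of the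
    weight, which is almost surely at most [g (delta * n)]. *)
Lemma partial_perpetuity_mgf_le n :
  (\int[P]_w (expR (c * partial_perpetuity n w))%:E <=
   (\prod_(k < n) (lambda / (lambda - c * g (delta * k%:R))))%:E)%E.
Proof.
elim: n => [|n IHn].
  rewrite big_ord0 (eq_integral (cst 1%E)).
    by rewrite integral_cst//= probability_setT mule1.
  by move=> w _; rewrite /partial_perpetuity big_ord0 mulr0 expR0.
pose h (z : R * R * R) : \bar R := (expR (c * z.1.1) * expR (c * z.1.2 * z.2))%:E.
have mh : measurable_fun setT h.
  apply/measurable_EFinP; apply: measurable_funM; apply: measurableT_comp => //.
    apply: measurable_funM => //; exact: measurableT_comp.
  apply: measurable_funM => //; apply: measurable_funM => //.
  exact: measurableT_comp.
have h0 z : (0 <= h z)%E by rewrite lee_fin mulr_ge0 ?expR_ge0.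
have mV : measurable_fun setT
    ((fun w => (partial_perpetuity n w, weight n w)) : \E n -> (R * R)%type).
  apply: measurable_fun_pair; first exact: measurable_partial_perpetuity_E.
  exact: measurable_weight_E.
rewrite (eq_integral
  (fun w => h ((partial_perpetuity n w, weight n w), E n w))); last first.
  by move=> w _; rewrite /h/= partial_perpetuityS mulrDr expRD mulrA.
rewrite (ge0_integral_others E_indep sZ_alg sZ_meas EZ_indep mV mh h0).
pose r := lambda / (lambda - c * g (delta * n%:R)).
apply: (@le_trans _ _ (\int[P]_w (r * expR (c * partial_perpetuity n w))%:E)%E).
  rewrite (eq_integral (fun w => (expR (c * partial_perpetuity n w) *
      (lambda / (lambda - c * weight n w)))%:E)); last first.
    move=> w _; rewrite /h/=; under eq_integral do rewrite EFinM.
    rewrite ge0_integralZl//; last first.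
      apply/measurable_EFinP; apply: (measurableT_comp (measurable_expR (R := R))).
      exact: mulrl_measurable.
    rewrite (integral_exponential_expR lambda_gt0 (E_law n)) ?EFinM//.
    by rewrite -subr_gt0; exact: rate_gt0 (psum_ge0 _ _).
  apply: ae_ge0_le_integral => //.
  - move=> w _; rewrite lee_fin mulr_ge0 ?expR_ge0// divr_ge0 ?(ltW lambda_gt0)//.
    exact/ltW/rate_gt0/psum_ge0.
  - apply/measurable_EFinP; apply: measurable_funM => //.
    apply: measurable_funM => //; apply: measurable_fun_inv.
      by move=> w; exact/rate_gt0/psum_ge0.
    apply: measurable_funB => //; apply: measurable_funM => //.
    exact: measurable_weight.
  - move=> w _; rewrite lee_fin mulr_ge0 ?expR_ge0// divr_ge0 ?(ltW lambda_gt0)//.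
    by apply/ltW/rate_gt0; rewrite mulr_ge0// ltW.
  - by apply/measurable_EFinP; exact: measurable_funM.
  apply: filterS ae_weight_le => w wle _; rewrite lee_fin mulrC ler_wpM2r ?expR_ge0//.
  rewrite ler_wpM2l ?(ltW lambda_gt0)// lef_pV2 ?posrE; last 2 first.
  - exact/rate_gt0/psum_ge0.
  - by apply/rate_gt0; rewrite mulr_ge0// ltW.
  by rewrite lerD2l lerN2 ler_wpM2l.
have r0 : 0 <= r.
  rewrite divr_ge0 ?(ltW lambda_gt0)//.
  by apply/ltW/rate_gt0; rewrite mulr_ge0// ltW.
under eq_integral do rewrite EFinM.
rewrite ge0_integralZl//; last first.
  exact/measurable_EFinP.
by rewrite big_ord_recr/= [leRHS]EFinM [leRHS]muleC lee_wpmul2l// lee_fin.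
Qed.

(** With [x = c * g (delta * k)], the factor [lambda / (lambda - x)] equals
    [1 + x / (lambda - x)], hence is at most [expR (x / (lambda - c * g 0))]; the
    exponents are summable. *)
Lemma partial_perpetuity_mgf_bounded : exists M : R, forall n,
  (\int[P]_w (expR (c * partial_perpetuity n w))%:E <= M%:E)%E.
Proof.
pose G := fine (\sum_(0 <= k <oo) (g (delta * k%:R))%:E)%E.
have d0 k : 0 <= delta * k%:R by rewrite mulr_ge0// ltW.
have rate0 : 0 < lambda - c * g 0 by exact: rate_gt0.
exists (expR (c / (lambda - c * g 0) * G)) => n.
apply: le_trans (partial_perpetuity_mgf_le n) _; rewrite lee_fin.
apply: (@le_trans _ _ (\prod_(k < n) expR (c / (lambda - c * g 0) * g (delta * k%:R)))).
  apply: ler_prod => k _; apply/andP; split.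
    by rewrite divr_ge0 ?(ltW lambda_gt0)// ltW// rate_gt0.
  apply: le_trans (expR_ge1Dx _).
  set a := g _; set D := _ - c * a; set D0 := _ - c * g 0.
  have D_gt0 : 0 < D by exact: rate_gt0.
  rewrite ler_pdivrMr// [leRHS](_ : _ = D + c * a * (D / D0)); last by ring.
  rewrite [leLHS](_ : _ = D + c * a); last by rewrite /D; ring.
  rewrite lerD2l ler_peMr ?mulr_ge0 ?g_ge0// ler_pdivlMr// mul1r.
  by rewrite lerD2l lerN2 g_le.
rewrite -expR_sum ler_expR -mulr_sumr ler_wpM2l//.
  by rewrite divr_ge0// ltW.
rewrite -lee_fin fineK; last first.
  rewrite ge0_fin_numE; first exact: weight_step_summable.
  by apply: nneseries_ge0 => k _ _; rewrite lee_fin g_ge0.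
rewrite -sumEFin -(big_mkord xpredT (fun k => (g (delta * k%:R))%:E)).
by apply: nneseries_lim_ge => k _ _; rewrite lee_fin g_ge0.
Qed.

(** Monotone convergence along the partial sums. *)
Lemma perpetuity_mgf_integrable :
  P.-integrable setT (fun w => (expR (c * fine (perpetuity w)))%:E).
Proof.
have [M Mn] := partial_perpetuity_mgf_bounded.
have mI : measurable_fun setT (fun w => (expR (c * fine (perpetuity w)))%:E).
  apply/measurable_EFinP; apply: measurableT_comp => //; apply: measurable_funM => //.
  apply: measurableT_comp; first exact: fine_measurable.
  exact: measurable_perpetuity.
apply/integrableP; split => //.
under eq_integral do rewrite /= ger0_norm ?expR_ge0//.
pose f n w := (expR (c * partial_perpetuity n w))%:E.
have mf n : measurable_fun setT (f n) by exact/measurable_EFinP.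
have f0 n w : (0 <= f n w)%E by rewrite lee_fin expR_ge0.
have nd_f w : {homo f^~ w : n m / (n <= m)%N >-> (n <= m)%E}.
  apply/nondecreasing_seqP => n; rewrite lee_fin ler_expR ler_wpM2l//.
  by rewrite partial_perpetuityS lerDl mulr_ge0// weight_ge0.
rewrite (@ae_eq_integral _ _ _ P setT (fun w => limn (f^~ w))) => [|//|//||];
  last 2 first.
- by apply: (emeasurable_fun_cvg f) => // w _; exact: ereal_nondecreasing_is_cvgn.
- apply: filterS perpetuity_ae_lty => w Iw _; apply/esym/cvg_lim => //.
  apply: cvg_EFin; first exact: nearW.
  apply: continuous_cvg; first exact: continuous_expR.
  apply: cvgMr; apply: (@fine_cvg _ _ _ _ (fun n => (partial_perpetuity n w)%:E)).
  by rewrite fineK ?ge0_fin_numE ?perpetuity_ge0//; exact: partial_perpetuity_cvg.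
apply: le_lt_trans (ltry M).
have := cvg_monotone_convergence (mu := P) measurableT mf
  (fun n w _ => f0 n w) (fun w _ => nd_f w).
move=> /cvg_lim <- //; apply: lime_le.
  apply: ereal_nondecreasing_is_cvgn => n m nm; apply: ge0_le_integral => // w _.
  exact: nd_f.
by apply: nearW.
Qed.

Lemma partial_perpetuity_mgf_integrable n :
  P.-integrable setT (fun w => (expR (c * partial_perpetuity n w))%:E).
Proof.
apply/integrableP; split; first exact/measurable_EFinP.
under eq_integral do rewrite /= ger0_norm ?expR_ge0//.
by apply: le_lt_trans (partial_perpetuity_mgf_le n) _; exact: ltry.
Qed.

End exponential_moment.

(** [x ^+ n <= n`! / c ^+ n * expR (c * x)] by the exponential series; any [c]
    strictly between [0] and [lambda / g 0] would do. *)
Lemma perpetuity_moment_lty n : (\int[P]_w (perpetuity w ^+ n) < +oo)%E.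
Proof.
have g0 : 0 < g 0 by exact: weight_gt0.
pose c := lambda / 2 / g 0.
have c0 : 0 < c by rewrite !divr_gt0.
have cg : c * g 0 < lambda by rewrite /c divfK ?gt_eqF//; have := lambda_gt0; lra.
pose C := n`!%:R / c ^+ n.
have pow_le m x : 0 <= x -> x ^+ m <= m`!%:R / c ^+ m * expR (c * x).
  move=> x0; rewrite mulrAC ler_pdivlMr ?exprn_gt0// -exprMn (mulrC x) [leRHS]mulrC.
  case: m => [|m]; first by rewrite expr0 fact0 mulr1 -expR0 ler_expR mulr_ge0// ltW.
  rewrite -ler_pdivrMr ?ltr0n ?fact_gt0//.
  by have := @expR_ge1Dxn _ (c * x) m (mulr_ge0 (ltW c0) x0); lra.
have /integrableP[mexp iexp] := perpetuity_mgf_integrable (ltW c0) cg.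
have mpow : measurable_fun setT (fun w => perpetuity w ^+ n)%E.
  elim: (n) => [|m IHm]; first exact: measurable_cst.
  rewrite (_ : (fun w => _) = (fun w => perpetuity w * perpetuity w ^+ m)%E).
    by apply: emeasurable_funM => //; exact: measurable_perpetuity.
  by apply/funext => w; rewrite expeS.
have C0 : 0 <= C by rewrite divr_ge0// exprn_ge0// ltW.
apply: (@le_lt_trans _ _ (\int[P]_w (C%:E * (expR (c * fine (perpetuity w)))%:E))%E).
  apply: ae_ge0_le_integral => //.
  - by move=> w _; rewrite expe_ge0// perpetuity_ge0.
  - by move=> w _; rewrite -EFinM lee_fin mulr_ge0// expR_ge0.
  - by apply: emeasurable_funM => //; exact: measurable_cst.
  apply: filterS perpetuity_ae_lty => w Iw _.
  have Ifin : perpetuity w \is a fin_num by rewrite ge0_fin_numE// perpetuity_ge0.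
  rewrite -[in leLHS](fineK Ifin) -EFin_expe -EFinM lee_fin pow_le//.
  by rewrite fine_ge0// perpetuity_ge0.
rewrite ge0_integralZl//.
rewrite lte_mul_pinfty ?lee_fin//.
rewrite (eq_integral (fun w => `|(expR (c * fine (perpetuity w)))%:E|%E))//.
by move=> w _; rewrite gee0_abs// lee_fin expR_ge0.
Qed.

(** ** The Laplace transform *)

Lemma cintegrable_le (F : T -> R[i]) (G : T -> R) :
  cmeasurable F -> (forall w, Normc.normc (F w) <= G w) ->
  P.-integrable setT (EFin \o G) -> cintegrable P F.
Proof.
move=> [mRe mIm] FG iG; split; apply: le_integrable iG => //.
- exact/measurable_EFinP.
- move=> w _; rewrite lee_fin (le_trans (normRe_le _))//.
  by rewrite (le_trans (FG w))// ler_norm.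
- exact/measurable_EFinP.
- move=> w _; rewrite lee_fin (le_trans (normIm_le _))//.
  by rewrite (le_trans (FG w))// ler_norm.
Qed.

Section laplace_transform.
Variable u : R[i].
Hypothesis u_gt : - (lambda / g 0) < complex.Re u.

(* The modulus of [exp (- u x)] is at most [expR (c * x)] for [x >= 0], and this
   [c] is admissible for the exponential moments. *)
Let c : R := Num.max 0 (- complex.Re u).
Let c_ge0 : 0 <= c. Proof. by rewrite le_max lexx. Qed.
Let c_ge : - c <= complex.Re u. Proof. by rewrite lerNl le_max lexx orbT. Qed.
Let g0_gt0 : 0 < g 0. Proof. exact: weight_gt0. Qed.
Let c_lt : c * g 0 < lambda.
Proof.
rewrite -ltr_pdivlMr// gt_max divr_gt0//=.
by rewrite ltrNl.
Qed.

Let normc_cexp_le x : 0 <= x -> Normc.normc (cexp (- u * x%:C%C)) <= expR (c * x).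
Proof.
move=> x0; rewrite normc_cexp ler_expR.
case: (u) c_ge => a b /= ac; rewrite mulr0 subr0 ler_wpM2r//.
by rewrite lerNl.
Qed.

Let phi k w : R[i] := lambda%:C%C / (lambda%:C%C + (weight k w)%:C%C * u).
Let B : R := lambda / (lambda - c * g 0).
Let B_ge0 : 0 <= B.
Proof. by rewrite divr_ge0 ?(ltW lambda_gt0)// subr_ge0 ltW. Qed.

Let rate_gt0 k w : 0 < lambda + weight k w * complex.Re u.
Proof.
rewrite -[X in _ + X]opprK subr_gt0 -mulrN mulrC.
apply: le_lt_trans c_lt; apply: (@le_trans _ _ (c * weight k w)).
  by rewrite ler_wpM2r ?weight_ge0// lerNl.
by rewrite ler_wpM2l// weight_le0.
Qed.

Let normc_phi_le k w : Normc.normc (phi k w) <= B.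
Proof. by apply: normc_laplace_le => //; rewrite weight_ge0 weight_le0. Qed.

Let normc_prod_phi_le (s : seq nat) w :
  Normc.normc (\prod_(k <- s) phi k w) <= B ^+ size s.
Proof.
elim: s => [|k s IHs]; first by rewrite big_nil Normc.normc1.
by rewrite big_cons Normc.normcM exprS ler_pM ?normc_ge0.
Qed.

Let cmeasurable_phi_E k n : cmeasurable (phi k : \E n -> R[i]).
Proof. by apply: cmeasurable_laplace => //; exact: measurable_weight_E. Qed.

(* The first [m] inter-arrival times enter through the exponential, the next
   ones, up to [K], only through their conditional Laplace transforms. *)
Let hybrid m K w : R[i] :=
  cexp (- u * (partial_perpetuity m w)%:C%C) * \prod_(m <= k < K) phi k w.

Let cmeasurable_hybrid m K : cmeasurable (hybrid m K : T -> R[i]).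
Proof.
apply: cmeasurableM; first exact/cmeasurable_cexp/measurable_partial_perpetuity.
apply: cmeasurable_prod => k; apply: cmeasurable_laplace => //.
exact: measurable_weight.
Qed.

Lemma cintegrable_hybrid m K : cintegrable P (hybrid m K).
Proof.
apply: (cintegrable_le
  (G := fun w => B ^+ (K - m) * expR (c * partial_perpetuity m w))).
- exact: cmeasurable_hybrid.
- move=> w; rewrite Normc.normcM mulrC ler_pM ?normc_ge0//.
    by have := normc_prod_phi_le (index_iota m K) w; rewrite size_iota.
  by rewrite normc_cexp_le// partial_perpetuity_ge0.
- rewrite (_ : EFin \o _ = fun w => ((B ^+ (K - m))%:E *
      (expR (c * partial_perpetuity m w))%:E)%E); last first.
    by apply/funext => w; rewrite /= EFinM.
  by apply: integrableZl => //; exact: partial_perpetuity_mgf_integrable.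
Qed.

(** Lowering [m] by one amounts to integrating out [E m].  The constant [z] is
    there to treat real and imaginary parts at once: the values [z = 1] and
    [z = - 'i] select the one and the other. *)
Let hybrid_peel (z : R[i]) m K : (m < K)%N ->
  (\int[P]_w (complex.Re (z * hybrid m.+1 K w))%:E =
   \int[P]_w (complex.Re (z * hybrid m K w))%:E)%E.
Proof.
move=> mK.
pose G w := z * (cexp (- u * (partial_perpetuity m w)%:C%C) *
                 \prod_(m.+1 <= k < K) phi k w).
have GS w : z * hybrid m.+1 K w = G w * cexp (- u * (weight m w * E m w)%:C%C).
  rewrite /hybrid /G partial_perpetuityS rmorphD/= mulrDr cexpD.
  by ring.
have Gm w : z * hybrid m K w = G w * phi m w.
  by rewrite /hybrid /G big_ltn//; ring.
have [mGre mGim] : cmeasurable (G : \E m -> R[i]).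
  apply: cmeasurableM; first exact: cmeasurable_cst.
  apply: cmeasurableM.
    by apply: cmeasurable_cexp; exact: measurable_partial_perpetuity_E.
  by apply: cmeasurable_prod => k; exact: cmeasurable_phi_E.
pose V w := ((complex.Re (G w), complex.Im (G w)), weight m w).
have mV : measurable_fun setT (V : \E m -> (R * R * R)%type).
  apply: measurable_fun_pair; first exact: measurable_fun_pair.
  exact: measurable_weight_E.
pose h (v : R * R * R * R) : \bar R := (complex.Re
  ((v.1.1.1 +i* v.1.1.2)%C * cexp (- u * (v.1.2 * v.2)%:C%C)))%:E.
have mh : measurable_fun setT h.
  have m1 : measurable_fun setT (fun v : R * R * R * R => v.1.2 * v.2).
    by apply: measurable_funM => //; exact: measurableT_comp.
  have [+ _] : cmeasurable (fun v : R * R * R * R =>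
      (v.1.1.1 +i* v.1.1.2)%C * cexp (- u * (v.1.2 * v.2)%:C%C)).
    apply: cmeasurableM; last exact: cmeasurable_cexp.
    split => /=.
      by apply: measurableT_comp => //; exact: measurableT_comp.
    by apply: measurableT_comp => //; exact: measurableT_comp.
  by move=> ?; exact/measurable_EFinP.
have hV w : h (V w, E m w) = (complex.Re (z * hybrid m.+1 K w))%:E.
  by rewrite /h/= GS; case: (G w).
have ih : P.-integrable setT (fun w => h (V w, E m w)).
  rewrite (_ : (fun w => _) = fun w =>
      ((complex.Re z)%:E * (complex.Re (hybrid m.+1 K w))%:E -
       (complex.Im z)%:E * (complex.Im (hybrid m.+1 K w))%:E)%E); last first.
    by apply/funext => w; rewrite hV ReM EFinB !EFinM.
  have [iRe iIm] := cintegrable_hybrid m.+1 K.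
  by apply: integrableB => //; exact: integrableZl.
transitivity (\int[P]_w h (V w, E m w))%E; first exact: eq_integral.
rewrite (integral_others E_indep sZ_alg sZ_meas EZ_indep mV mh ih).
apply: eq_integral => w _; rewrite Gm.
rewrite -(integral_exponential_cexp lambda_gt0 (E_law m)); last exact: rate_gt0.
by apply: eq_integral => y _; rewrite /h /V; case: (G w).
Qed.

Let hybrid_full (z : R[i]) K m : (m <= K)%N ->
  (\int[P]_w (complex.Re (z * hybrid m K w))%:E =
   \int[P]_w (complex.Re (z * hybrid 0 K w))%:E)%E.
Proof.
elim: m => [//|m IHm] mK; rewrite hybrid_peel//.
by apply: IHm; exact: ltnW.
Qed.

Let hybrid0 K : hybrid 0 K.+1 = laplace_product lambda g Z u K.
Proof.
apply/funext => w.
by rewrite /hybrid /partial_perpetuity big_ord0 mulr0 cexp0 mul1r.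
Qed.

Lemma cintegrable_laplace_product K : cintegrable P (laplace_product lambda g Z u K).
Proof. by rewrite -hybrid0; exact: cintegrable_hybrid. Qed.

Let cmeasurable_integrand : cmeasurable (laplace_integrand perpetuity u).
Proof.
apply: cmeasurable_cexp; apply: measurableT_comp; first exact: fine_measurable.
exact: measurable_perpetuity.
Qed.

Lemma cintegrable_laplace_integrand : cintegrable P (laplace_integrand perpetuity u).
Proof.
apply: (cintegrable_le (G := fun w => expR (c * fine (perpetuity w)))) => //.
  by move=> w; rewrite normc_cexp_le// fine_ge0// perpetuity_ge0.
exact: perpetuity_mgf_integrable.
Qed.

Let laplace_cvg (z : R[i]) : Normc.normc z <= 1 ->
  (\int[P]_w (complex.Re (z * laplace_product lambda g Z u K w))%:E @[K --> \oo] -->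
   \int[P]_w (complex.Re (z * laplace_integrand perpetuity u w))%:E)%E.
Proof.
move=> z1.
pose f n w := (complex.Re (z * cexp (- u * (partial_perpetuity n.+1 w)%:C%C)))%:E.
rewrite (_ : (fun K => _) = fun n => (\int[P]_w f n w)%E); last first.
  apply/funext => K; rewrite -hybrid0 -(hybrid_full z (leqnn K.+1)).
  by apply: eq_integral => w _; rewrite /hybrid big_geq// mulr1.
have zM F : cmeasurable F ->
    measurable_fun [set: T] (fun w => (complex.Re (z * F w))%:E).
  move=> mF; apply/measurable_EFinP.
  by have [] := cmeasurableM (@cmeasurable_cst _ _ T z) mF.
have [//|||||_ _ //] := @dominated_convergence _ _ _ P setT measurableT f
  (fun w => (complex.Re (z * laplace_integrand perpetuity u w))%:E)
  (fun w => (expR (c * fine (perpetuity w)))%:E).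
- move=> n; apply: zM; apply: cmeasurable_cexp.
  exact: measurable_partial_perpetuity.
- exact: zM.
- apply: filterS perpetuity_ae_lty => w Iw _.
  have Sw : partial_perpetuity n.+1 w @[n --> \oo] --> fine (perpetuity w).
    rewrite (cvg_shiftS (fun n => partial_perpetuity n w)).
    apply: (@fine_cvg _ _ _ _ (fun n => (partial_perpetuity n w)%:E)).
    by rewrite fineK ?ge0_fin_numE ?perpetuity_ge0//; exact: partial_perpetuity_cvg.
  apply: cvg_EFin; first exact: nearW.
  rewrite /f /laplace_integrand Re_mul_cexp.
  under [X in X @ _ --> _]eq_fun do rewrite /= Re_mul_cexp.
  apply: cvgM.
    apply: continuous_cvg; first exact: continuous_expR.
    exact: cvgMr.
  apply: cvgD; apply: cvgMr.
    by apply: continuous_cvg; [exact: continuous_cos|exact: cvgMr].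
  by apply: continuous_cvg; [exact: continuous_sin|exact: cvgMr].
- exact: perpetuity_mgf_integrable.
- apply: filterS perpetuity_ae_lty => w Iw n _; rewrite lee_fin.
  rewrite (le_trans (normRe_le _))// Normc.normcM.
  apply: (@le_trans _ _ (expR (c * partial_perpetuity n.+1 w))).
    rewrite -[leRHS]mul1r ler_pM ?normc_ge0// normc_cexp_le//.
    exact: partial_perpetuity_ge0.
  rewrite ler_expR ler_wpM2l// -lee_fin fineK ?ge0_fin_numE ?perpetuity_ge0//.
  rewrite /partial_perpetuity -sumEFin.
  rewrite -(big_mkord xpredT (fun k => (weight k w * E k w)%:E)).
  by apply: nneseries_lim_ge => k _ _; rewrite lee_fin mulr_ge0// weight_ge0.
Qed.

Lemma laplace_product_cvg :
  (fun K : nat => cexpectation P (laplace_product lambda g Z u K) : R[i]^o)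
    @ \oo --> (laplace_transform P perpetuity u : R[i]^o).
Proof.
have [iRe iIm] := cintegrable_laplace_integrand.
have int1 F : (\int[P]_w (complex.Re (1 * F w))%:E = \int[P]_w (complex.Re (F w))%:E)%E.
  by apply: eq_integral => w _; rewrite mul1r.
have intNi F : (\int[P]_w (complex.Re (- 'i%C * F w))%:E =
    \int[P]_w (complex.Im (F w))%:E)%E.
  apply: eq_integral => w _; rewrite ReM/=; congr _%:E.
  by rewrite oppr0 mul0r add0r mulN1r opprK.
have := @laplace_cvg 1; rewrite Normc.normc1 => /(_ (lexx _)).
rewrite int1 (_ : (fun K => _) = fun K =>
    (\int[P]_w (complex.Re (laplace_product lambda g Z u K w))%:E)%E); last first.
  by apply/funext => K; rewrite int1.
rewrite -[X in _ --> X -> _]fineK; last exact: integrable_fin_num.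
move=> /fine_cvg cRe.
have := @laplace_cvg (- 'i%C).
rewrite (_ : Normc.normc _ = 1); last first.
  by rewrite /= oppr0 expr0n/= add0r sqrrN expr1n sqrtr1.
rewrite intNi (_ : (fun K => _) = fun K =>
    (\int[P]_w (complex.Im (laplace_product lambda g Z u K w))%:E)%E); last first.
  by apply/funext => K; rewrite intNi.
move=> /(_ (lexx _)).
rewrite -[X in _ --> X -> _]fineK; last exact: integrable_fin_num.
move=> /fine_cvg cIm.
exact: cvg_complex.
Qed.

End laplace_transform.
End bounded_away_jumps.

End perpetuity.

(** * The integral of the compound Poisson process *)

Lemma path_integral_compound_process d (T : measurableType d) (R : realType)
    (P : probability T R) (N : R -> {RV P >-> nat}) (E Z : nat -> {RV P >-> R})
    (g : R -> R) :
  (forall k w, 0 <= E k w) ->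
  (forall t w, 0 <= t -> psum E (N t w) w <= t < psum E (N t w).+1 w) ->
  (forall i w, 0 <= Z i w) -> (forall x, 0 <= x -> 0 <= g x) ->
  path_integral g (compound_process N Z) = perpetuity E Z g.
Proof.
move=> E0 EN Z0 g0; apply/funext => w.
have psumS k : psum E k.+1 w = psum E k w + E k w by rewrite /psum big_ord_recr.
rewrite /path_integral /compound_process.
rewrite (integral_jump_count (s := fun k => psum E k w) (n := fun t => N t w) _ _ _
  (c := fun k => g (psum Z k w))).
- by apply: eq_eseriesr => k _; rewrite psumS addrAC subrr add0r.
- by rewrite /psum big_ord0.
- by move=> k; rewrite psumS lerDl.
- by move=> t; exact: EN.
- by move=> k; rewrite g0// /psum sumr_ge0.
Qed.

Theorem theorem3p19 (d : measure_display) (T : measurableType d)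
  (R : realType) (P : probability T R)
  (lambda : R) (N : R -> {RV P >-> nat}) (Z : nat -> {RV P >-> R})
  (g : R -> R)
  (lambda_gt0 : 0 < lambda)
  (N_poisson : poisson_process lambda N)
  (Z_indep : mutually_independent Z)
  (Z_ident : identically_distributed Z)
  (Z_ge0 : forall i w, 0 <= Z i w)
  (Z_pos : (0 < P [set w | (0 < Z 0%N w)%R])%E)
  (NZ_indep : independent_salgebras P
     (generated_salgebra [set t : R | 0 <= t] N)
     (generated_salgebra [set: nat] Z))
  (g_ge0 : forall x, 0 <= x -> 0 <= g x)
  (g_bounded : exists M, forall x, 0 <= x -> g x <= M)
  (g_decr : forall x y, 0 <= x -> x < y -> g y < g x)
  (g_summable : cvgn (fun n : nat => \sum_(1 <= k < n) g k%:R)) :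
  let I := path_integral g (compound_process N Z) in
  ({ae P, forall w, (I w < +oo)%E} /\
   has_density_on P [set x : R | 0 < x] I) /\
  ((exists2 delta : R, 0 < delta & P [set w | delta < Z 0%N w] = 1%E) ->
   [/\ forall u : R[i], - (lambda / g 0) < complex.Re u ->
         cintegrable P (laplace_integrand I u),
       forall n : nat, (\int[P]_w (I w ^+ n) < +oo)%E &
       forall u : R[i], - (lambda / g 0) < complex.Re u ->
         (forall K : nat, cintegrable P (laplace_product lambda g Z u K)) /\
         (fun K : nat => cexpectation P (laplace_product lambda g Z u K) : R[i]^o)
           @ \oo --> (laplace_transform P I u : R[i]^o)]).
Proof.
have [E [E_indep E_law E_ge0 EN]] := N_poisson.
have EZ_indep : independent_salgebras P
    (generated_salgebra [set: nat] E) (generated_salgebra [set: nat] Z).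
  by move=> A B /(arrivals_in_salgebra E_ge0 EN) NA ZB; exact: NZ_indep.
rewrite (path_integral_compound_process E_ge0 EN Z_ge0 g_ge0) => I.
split.
  split; first exact: (perpetuity_ae_lty lambda_gt0 E_indep E_law).
  exact: (perpetuity_has_density lambda_gt0 E_indep E_law).
move=> [delta delta_gt0 Z_delta]; split.
- exact: (cintegrable_laplace_integrand lambda_gt0 E_indep E_law E_ge0 Z_indep
    Z_ident Z_ge0 EZ_indep g_ge0 g_decr g_summable Z_pos delta_gt0 Z_delta).
- exact: (perpetuity_moment_lty lambda_gt0 E_indep E_law E_ge0 Z_indep
    Z_ident Z_ge0 EZ_indep g_ge0 g_decr g_summable Z_pos delta_gt0 Z_delta).
- move=> u u_gt; split.
    exact: (cintegrable_laplace_product lambda_gt0 E_indep E_law E_ge0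
      Z_ident Z_ge0 EZ_indep g_ge0 g_decr delta_gt0 Z_delta u_gt).
  exact: (laplace_product_cvg lambda_gt0 E_indep E_law E_ge0 Z_indep
    Z_ident Z_ge0 EZ_indep g_ge0 g_decr g_summable Z_pos delta_gt0 Z_delta u_gt).
Qed.
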